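(* Let $n>1$ and let $\mathcal{K}_n$ be a naturally oriented weighted complete graph on the vertices $x_1,\ldots,x_n$ such that $w_p>1$ for some $p\geq 2$. Let $R=k[x_1,\ldots,x_n]$. Then (a) $\operatorname{pdim}(R/I(\mathcal{K}_n))=n-1$, and (b) $\displaystyle \operatorname{reg}(R/I(\mathcal{K}_n))=\sum_{i=1}^n w_i-n+1.$
   Context: A weighted oriented graph is a finite simple graph in which each edge is given exactly one orientation, together with a function $w$ from the vertices to the positive integers; write $w_i=w(x_i)$, and write $(x_i,x_j)$ for an edge oriented from $x_i$ to $x_j$. A weighted oriented complete graph $\mathcal{K}_n$ on $\{x_1,\ldots,x_n\}$ is called naturally oriented if its oriented edge set is $\{(x_i,x_j) : 1\leq i<j\leq n\}$. Its edge ideal in $R=k[x_1,\ldots,x_n]$ ($k$ a field) is $I(\mathcal{K}_n)=(x_ix_j^{w_j} : 1\leq i<j\leq n)$. Since $x_1$ is a source vertex (only outgoing edges), one sets $w_1=1$. $\operatorname{pdim}$ is projective dimension over $R$ and $\operatorname{reg}(R/I)=\max\{j-i : \beta_{i,j}(R/I)\neq 0\}$ is Castelnuovo–Mumford regularity. *)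

(* Defs.v *)
From HB Require Import structures.
From mathcomp Require Import all_boot all_order all_algebra.
From mathcomp Require Import boolp.
From mathcomp Require Import mpoly.

Set Implicit Arguments.
Unset Strict Implicit.
Unset Printing Implicit Defensive.

Import Order.TTheory GRing.Theory Num.Theory.
Local Open Scope ring_scope.
Local Open Scope quotient_scope.

Section QuotientModule.
Variables (R : comNzRingType) (V : lmodType R) (N : submodClosed V).

(* Over a ring, closure under scaling gives closure under opposite; this is
   the underlying additive subgroup, to which Quotient.quot applies. *)
Definition submod_pred : {pred V} := N.

Lemma submod_pred_zmod_closed : zmod_closed submod_pred.
Proof.
split=> [|x y xN yN]; first exact: (rpred0 N).
by rewrite unfold_in -scaleN1r; apply: (rpredD (S := N)) => //; apply: rpredZ.
Qed.

HB.instance Definition _ :=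
  GRing.isZmodClosed.Build V submod_pred submod_pred_zmod_closed.

Definition quotmod := Quotient.quot submod_pred.

HB.instance Definition _ := GRing.Zmodule.on quotmod.

Definition quotmod_pi (v : V) : quotmod := \pi_(Quotient.quot submod_pred) v.

Definition quotmod_scale (a : R) (x : quotmod) : quotmod :=
  quotmod_pi (a *: repr x).

Lemma quotmod_piP u v : quotmod_pi u = quotmod_pi v <-> u - v \in N.
Proof.
rewrite /quotmod_pi; split=> [/eqP|uv]; last apply/eqP.
  by rewrite -Quotient.idealrBE.
by rewrite -Quotient.idealrBE.
Qed.

Lemma quotmod_reprK (x : quotmod) : quotmod_pi (repr x) = x.
Proof. exact: reprK. Qed.

Lemma quotmod_piD : {morph quotmod_pi : u v / u + v}.
Proof. by move=> u v; apply: (@raddfD _ _ \pi_(Quotient.quot submod_pred)). Qed.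

Lemma quotmod_scale_pi a v : quotmod_scale a (quotmod_pi v) = quotmod_pi (a *: v).
Proof.
apply/quotmod_piP; rewrite -scalerBr; apply: rpredZ.
by apply/quotmod_piP; rewrite quotmod_reprK.
Qed.

Lemma quotmod_scaleA a b x :
  quotmod_scale a (quotmod_scale b x) = quotmod_scale (a * b) x.
Proof. by rewrite -[x]quotmod_reprK !quotmod_scale_pi scalerA. Qed.

Lemma quotmod_scale1 : left_id 1 quotmod_scale.
Proof. by move=> x; rewrite -[x]quotmod_reprK quotmod_scale_pi scale1r. Qed.

Lemma quotmod_scaleDr : right_distributive quotmod_scale +%R.
Proof.
move=> a x y; rewrite -[x]quotmod_reprK -[y]quotmod_reprK -quotmod_piD.
by rewrite !quotmod_scale_pi scalerDr quotmod_piD.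
Qed.

Lemma quotmod_scaleDl x : {morph quotmod_scale^~ x : a b / a + b}.
Proof.
move=> a b; rewrite -[x]quotmod_reprK.
by rewrite !quotmod_scale_pi scalerDl quotmod_piD.
Qed.

HB.instance Definition _ := GRing.Zmodule_isLmodule.Build R quotmod
  quotmod_scaleA quotmod_scale1 quotmod_scaleDr quotmod_scaleDl.

End QuotientModule.

Section GeneratedIdeal.
Variables (R : comNzRingType) (T : finType) (P : pred T) (g : T -> R).

Definition ideal_gen : {pred R^o} :=
  fun p => `[< exists c : T -> R, p = \sum_(t | P t) c t * g t >].

Lemma ideal_gen_submod_closed : submod_closed ideal_gen.
Proof.
split=> [|a p q /asboolP[c ->] /asboolP[d ->]]; apply/asboolP.
  by exists (fun=> 0); rewrite big1 // => t _; rewrite mul0r.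
exists (fun t => a * c t + d t).
rewrite scaler_sumr -big_split; apply: eq_bigr => t _ /=.
by rewrite mulrDl -mulrA.
Qed.

HB.instance Definition _ :=
  GRing.isSubmodClosed.Build R R^o ideal_gen ideal_gen_submod_closed.

End GeneratedIdeal.

Section ProjectiveDimension.
Variable R : comNzRingType.

Definition projective (P : lmodType R) : Prop :=
  forall (A B : lmodType R) (g : {linear A -> B}) (f : {linear P -> B}),
    (forall b, exists a, g a = b) ->
    exists h : {linear P -> A}, forall x, g (h x) = f x.

Record projective_resolution (M : lmodType R) := ProjectiveResolution {
  pr_mod : nat -> lmodType R;
  pr_diff : forall i, {linear pr_mod i.+1 -> pr_mod i};
  pr_aug : {linear pr_mod 0 -> M};
  pr_projective : forall i, projective (pr_mod i);
  pr_aug_surj : forall m, exists x, pr_aug x = m;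
  pr_aug_exact : forall x, pr_aug x = 0 <-> exists y, pr_diff 0 y = x;
  pr_exact : forall i (x : pr_mod i.+1),
    pr_diff i x = 0 <-> exists y, pr_diff i.+1 y = x
}.

Definition pr_length_le (M : lmodType R) (P : projective_resolution M) (d : nat) :
    Prop :=
  forall i, (d < i)%N -> forall x : pr_mod P i, x = 0.

(* [pdim_is M d] reads pdim M = d; no d qualifies when pdim M is infinite. *)
Definition pdim_is (M : lmodType R) (d : nat) : Prop :=
  (exists P : projective_resolution M, pr_length_le P d) /\
  (forall (P : projective_resolution M) (e : nat), pr_length_le P e -> (d <= e)%N).

End ProjectiveDimension.

Section Regularity.
Variables (k : fieldType) (n : nat).
Local Notation R := {mpoly k[n]}.

(* The degree-d piece of R; it is zero for d < 0. *)
Definition homog_deg (d : int) (p : R) : Prop :=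
  match d with
  | Posz m => p \is m.-homog
  | Negz _ => p = 0
  end.

(* [gr d x] says that x lies in the degree-d piece of M. Row vectors are used
   for free modules, so the differential F_(i+1) -> F_i is v |-> v *m gf_diff i.
   The r-th basis vector of F_i has degree [gf_shift i r], i.e. F_i is the
   direct sum of the R(- gf_shift i r). *)
Record graded_free_resolution (M : lmodType R) (gr : int -> M -> Prop) :=
  GradedFreeResolution {
  gf_rank : nat -> nat;
  gf_shift : forall i, 'I_(gf_rank i) -> int;
  gf_diff : forall i, 'M[R]_(gf_rank i.+1, gf_rank i);
  gf_aug : {linear 'rV[R]_(gf_rank 0) -> M};
  gf_aug_homog : forall r, gr (gf_shift (i := 0%N) r) (gf_aug (delta_mx 0 r));
  gf_diff_homog : forall i r c,
    homog_deg (gf_shift (i := i.+1) r - gf_shift (i := i) c) (gf_diff i r c);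
  gf_aug_surj : forall m, exists u, gf_aug u = m;
  gf_aug_exact : forall u, gf_aug u = 0 <-> exists v, v *m gf_diff 0 = u;
  gf_exact : forall i (u : 'rV_(gf_rank i.+1)),
    u *m gf_diff i = 0 <-> exists v, v *m gf_diff i.+1 = u
}.

(* The differentials have entries in the maximal ideal (x_1, ..., x_n). *)
Definition gf_minimal (M : lmodType R) (gr : int -> M -> Prop)
    (F : graded_free_resolution gr) : Prop :=
  forall i r c, (gf_diff F i r c)@_0%MM = 0.

(* [graded_betti_is gr i j b] reads beta_{i,j}(M) = b. It is a relation because
   the minimal graded free resolution is unique only up to isomorphism. *)
Definition graded_betti_is (M : lmodType R) (gr : int -> M -> Prop)
    (i : nat) (j : int) (b : nat) : Prop :=
  exists F : graded_free_resolution gr,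
    gf_minimal F /\ #|[set r | gf_shift (g := F) (i := i) r == j]| = b.

Definition regularity_is (M : lmodType R) (gr : int -> M -> Prop) (r : int) :
    Prop :=
  (exists i j b, [/\ graded_betti_is gr i j b, b <> 0%N & j - i%:Z = r]) /\
  (forall i j b, graded_betti_is gr i j b -> b <> 0%N -> j - i%:Z <= r).

Definition quot_homog (I : submodClosed R^o) (d : int) (x : quotmod I) : Prop :=
  exists2 p : R, homog_deg d p & quotmod_pi I p = x.

End Regularity.

(* [wog_oriented] excludes both loops and pairs of opposite edges. *)
Record weighted_oriented_graph (n : nat) := WeightedOrientedGraph {
  wog_edge : rel 'I_n;
  wog_weight : 'I_n -> nat;
  wog_oriented : forall i j, wog_edge i j -> ~~ wog_edge j i;
  wog_weight_gt0 : forall i, (0 < wog_weight i)%N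
}.

(* The vertex x_i is the element of value i - 1 in 'I_n. *)
Definition naturally_oriented_complete (n : nat) (G : weighted_oriented_graph n) :
    Prop :=
  forall i j : 'I_n, wog_edge G i j = (i < j)%N.

Definition edge_ideal (k : fieldType) (n : nat) (G : weighted_oriented_graph n) :
    submodClosed {mpoly k[n]}^o :=
  @ideal_gen {mpoly k[n]} ('I_n * 'I_n)%type (fun e => wog_edge G e.1 e.2)
    (fun e => 'X_(e.1) * 'X_(e.2) ^+ wog_weight G e.2).

(* Main.v *)
(** Write x_i for the variables and y_j = x_j ^ w_j. A minimal free resolution
    of R / I(K_n) has, in homological degree d > 0, one basis element for each
    pair of nonempty index sets A < B (every element of A below every element
    of B) with |A| + |B| = d + 1, of multidegree prod_A x_i prod_B y_j; its
    differential deletes one index of A or B, as in the tensor product of two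
    Koszul complexes. In a fixed multidegree a it becomes the chain complex of
    the pairs A < B with x_i | a on A and y_j | a on B. This is exact: with v
    the least x-index and u > v some y-index, first match (A, B) with
    (A + v, B), then ({v}, B) with ({v}, B + u), then the empty face with
    ({v}, {u}), and eliminate along these matchings. The longest basis element
    and the largest value of degree minus d both occur at A = {1},
    B = {2, ..., n}.

    Independence of the resolution: if X is a minimal free resolution, any
    chain map f : X -> Y over the identity is injective modulo (x_1, ..., x_n),
    because a lift g : Y -> X makes g f homotopic to the identity. With Y a
    short projective resolution this bounds pdim from below; with f homogeneous
    it places the degrees of X among those of Y. *)

Require Import Defs.
From HB Require Import structures.
From mathcomp Require Import all_boot all_order all_algebra.
From mathcomp Require Import boolp.
From mathcomp Require Import mpoly.
From mathcomp Require Import zify.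
Import Order.TTheory GRing.Theory Num.Theory.
Local Open Scope ring_scope.

Set Implicit Arguments.
Unset Strict Implicit.
Unset Printing Implicit Defensive.

(** * Lifting along projective modules *)

Section Lifting.
Variable R : comNzRingType.

Section RowCombination.
Variables (m : nat) (A : lmodType R) (a : 'I_m -> A).

Definition row_comb (u : 'rV[R]_m) : A := \sum_r u 0 r *: a r.

Lemma row_comb_is_linear : linear row_comb.
Proof.
move=> c u v; rewrite /row_comb scaler_sumr -big_split /=.
by apply: eq_bigr => r _; rewrite !mxE scalerDl scalerA.
Qed.

HB.instance Definition _ :=
  GRing.isLinear.Build R 'rV[R]_m A *:%R row_comb row_comb_is_linear.

Lemma row_comb_delta r : row_comb (delta_mx 0 r) = a r.
Proof.
rewrite /row_comb (bigD1 r) //= mxE !eqxx scale1r big1 ?addr0 // => s sr.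
by rewrite mxE eqxx (negPf sr) scale0r.
Qed.

End RowCombination.

Lemma row_linear_ex m (A : lmodType R) (a : 'I_m -> A) :
  exists h : {linear 'rV[R]_m -> A}, forall r, h (delta_mx 0 r) = a r.
Proof.
by exists (row_comb a : {linear _ -> _}) => r; apply: row_comb_delta.
Qed.

Lemma row_linear_comb m (A : lmodType R) (f : {linear 'rV[R]_m -> A}) u :
  f u = \sum_r u 0 r *: f (delta_mx 0 r).
Proof.
rewrite {1}(row_sum_delta u) linear_sum /=.
by apply: eq_bigr => r _; rewrite linearZ.
Qed.

Lemma row_linear_eq m (A : lmodType R) (f g : {linear 'rV[R]_m -> A}) :
  (forall r, f (delta_mx 0 r) = g (delta_mx 0 r)) -> forall u, f u = g u.
Proof.
move=> fg u; rewrite (row_linear_comb f) (row_linear_comb g).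
by apply: eq_bigr => r _; rewrite fg.
Qed.

(** Preimages are chosen on the basis vectors. Asking only that [f] land in the image of [g] is what
    exactness of a complex supplies. *)
Lemma row_lift m (A B : lmodType R) (g : {linear A -> B})
    (f : {linear 'rV[R]_m -> B}) :
  (forall x, exists a, g a = f x) ->
  exists h : {linear 'rV[R]_m -> A}, forall x, g (h x) = f x.
Proof.
move=> fg; have /choice[a ga] r := fg (delta_mx 0 r).
have [h hE] := row_linear_ex a; exists h.
by apply: (@row_linear_eq _ _ (g \o h) f) => r /=; rewrite hE.
Qed.

Lemma row_projective m : projective 'rV[R]_m.
Proof. by move=> A B g f gs; apply: row_lift => x; apply: gs. Qed.

Section Kernel.
Variables (A B : lmodType R) (g : {linear A -> B}).

Definition ker_pred : {pred A} := fun x => g x == 0.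

Lemma ker_pred_submod_closed : submod_closed ker_pred.
Proof.
split=> [|c x y]; rewrite !unfold_in ?linear0 //.
by move=> /eqP gx /eqP gy; rewrite linearP gx gy scaler0 addr0.
Qed.

HB.instance Definition _ := GRing.isSubmodClosed.Build R A ker_pred
  ker_pred_submod_closed.

Definition ker_pi : A -> quotmod ker_pred := quotmod_pi ker_pred.

Lemma ker_pi_is_linear : linear ker_pi.
Proof.
move=> c x y; rewrite /ker_pi quotmod_piD; congr (_ + _).
exact/esym/quotmod_scale_pi.
Qed.

HB.instance Definition _ := GRing.isLinear.Build R A (quotmod ker_pred) *:%R
  ker_pi ker_pi_is_linear.

Lemma ker_piP x y : ker_pi x = ker_pi y <-> g x = g y.
Proof.
rewrite /ker_pi quotmod_piP unfold_in linearB subr_eq0.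
by split=> [/eqP|->].
Qed.

Variables (P : lmodType R) (f : {linear P -> B}).
Hypothesis fg : forall x, exists a, g a = f x.

(** [A / ker g] models the image of [g]; the chosen preimage of [f x] is determined modulo the
    kernel, which makes the map linear. *)
Definition ker_factor (x : P) : quotmod ker_pred := ker_pi (sval (cid (fg x))).

Lemma ker_factor_is_linear : linear ker_factor.
Proof.
have E x : g (sval (cid (fg x))) = f x by exact: (svalP (cid (fg x))).
move=> c x y; rewrite /ker_factor.
rewrite -[RHS](linearP (ker_pi : {linear _ -> _})); apply/ker_piP.
by rewrite E [RHS](linearP g) !E linearP.
Qed.

HB.instance Definition _ := GRing.isLinear.Build R P (quotmod ker_pred) *:%R
  ker_factor ker_factor_is_linear.

(* The lifting property of P is tested on A -> A / ker g, which is onto. *)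
Lemma projective_lift : projective P ->
  exists h : {linear P -> A}, forall x, g (h x) = f x.
Proof.
move=> /(_ _ _ (ker_pi : {linear _ -> _}) (ker_factor : {linear _ -> _}))[].
  by move=> b; exists (repr b); apply: quotmod_reprK.
move=> h hP; exists h => x; move: (hP x) => /= /ker_piP ->.
exact: (svalP (cid (fg x))).
Qed.

End Kernel.

End Lifting.

(** * Comparison with a minimal resolution *)

Section Comparison.
Variables (k : fieldType) (n : nat).
Local Notation R := {mpoly k[n]}.
Variables (M : lmodType R) (gr : int -> M -> Prop).
Variables (F : graded_free_resolution gr) (Y : projective_resolution M).
Local Notation X i := 'rV[R]_(gf_rank F i).
Local Notation "x *d i" := (x *m gf_diff F i) (at level 40, i at level 9).

Lemma gf_diffK i (x : X i.+2) : x *d i.+1 *d i = 0.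
Proof. by apply/gf_exact; exists x. Qed.

Lemma gf_augK (x : X 1) : gf_aug F (x *d 0) = 0.
Proof. by apply/gf_aug_exact; exists x. Qed.

Lemma pr_diffK i (y : pr_mod Y i.+2) : pr_diff Y i (pr_diff Y i.+1 y) = 0.
Proof. by apply/pr_exact; exists y. Qed.

Lemma pr_augK (y : pr_mod Y 1) : pr_aug Y (pr_diff Y 0 y) = 0.
Proof. by apply/pr_aug_exact; exists y. Qed.

Local Notation D i := (mulmxr (gf_diff F i) : {linear X i.+1 -> X i}).

Lemma lift_to_free_aug : exists g : {linear pr_mod Y 0 -> X 0},
  forall y, gf_aug F (g y) = pr_aug Y y.
Proof.
apply: projective_lift; last exact: pr_projective.
by move=> y; apply: gf_aug_surj.
Qed.

Lemma lift_to_free1 (g : {linear pr_mod Y 0 -> X 0}) :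
    (forall y, gf_aug F (g y) = pr_aug Y y) ->
  exists g' : {linear pr_mod Y 1 -> X 1},
    forall y, g' y *d 0 = g (pr_diff Y 0 y).
Proof.
move=> gE; apply: (@projective_lift _ _ _ (D 0) _ (g \o pr_diff Y 0)).
  by move=> y /=; apply/gf_aug_exact; rewrite gE pr_augK.
exact: pr_projective.
Qed.

Lemma lift_to_freeS i (g : {linear pr_mod Y i -> X i})
    (g' : {linear pr_mod Y i.+1 -> X i.+1}) :
    (forall y, g' y *d i = g (pr_diff Y i y)) ->
  exists g'' : {linear pr_mod Y i.+2 -> X i.+2},
    forall y, g'' y *d i.+1 = g' (pr_diff Y i.+1 y).
Proof.
move=> gE; apply: (@projective_lift _ _ _ (D i.+1) _ (g' \o pr_diff Y i.+1)).
  by move=> y /=; apply/gf_exact; rewrite gE pr_diffK linear0.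
exact: pr_projective.
Qed.

(* Phi selects the chain maps X -> Y that may be used: all of them for
   projective dimension, those of degree 0 for graded Betti numbers. *)
Variable Phi : forall i, {linear X i -> pr_mod Y i} -> Prop.

Hypothesis Phi0 : exists2 f : {linear X 0 -> pr_mod Y 0},
  Phi f & forall x, pr_aug Y (f x) = gf_aug F x.

Hypothesis PhiS : forall i (f : {linear X i -> pr_mod Y i}), Phi f ->
  (forall x, exists y, pr_diff Y i y = f (x *d i)) ->
  exists2 f' : {linear X i.+1 -> pr_mod Y i.+1},
    Phi f' & forall x, pr_diff Y i (f' x) = f (x *d i).

(** Two consecutive components of the chain maps and of the homotopy are all that the inductive step
    consumes, so no infinite family of maps has to be built. *)
Definition local_homotopy i : Prop :=
  exists (f : {linear X i -> pr_mod Y i})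
    (f' : {linear X i.+1 -> pr_mod Y i.+1})
    (g : {linear pr_mod Y i -> X i}) (g' : {linear pr_mod Y i.+1 -> X i.+1})
    (s : {linear X i -> X i.+1}) (s' : {linear X i.+1 -> X i.+2}),
  [/\ Phi f', forall x, pr_diff Y i (f' x) = f (x *d i),
      forall y, g' y *d i = g (pr_diff Y i y)
    & forall x, g' (f' x) - x = s (x *d i) + s' x *d i.+1].

(** The bottom degree is stated apart: there the homotopy has the single term [s x *d 0], whereas
    [local_homotopy i] speaks of degree [i.+1]. *)
Lemma homotopy0 :
  (exists (f : {linear X 0 -> pr_mod Y 0}) (g : {linear pr_mod Y 0 -> X 0})
     (s : {linear X 0 -> X 1}), Phi f /\ forall x, g (f x) - x = s x *d 0)
  /\ local_homotopy 0.
Proof.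
have [f Ff fE] := Phi0; have [g gE] := lift_to_free_aug.
have [s sE] : exists s : {linear X 0 -> X 1},
    forall x, s x *d 0 = g (f x) - x.
  apply: (@row_lift _ _ _ _ (D 0) (g \o f \- idfun)) => x /=.
  by apply/gf_aug_exact; rewrite linearB /= gE fE subrr.
split; first by exists f, g, s; split.
have [g' g'E] := lift_to_free1 gE.
have [x|f' Ff' f'E] := PhiS Ff.
  by apply/pr_aug_exact; rewrite fE gf_augK.
have [s' s'E] : exists s' : {linear X 1 -> X 2},
    forall x, s' x *d 1 = g' (f' x) - x - s (x *d 0).
  (* By the homotopy equation one degree lower, g f - id - s d takes values in cycles, so it lifts
     through the next differential. *)
  pose h : {linear X 1 -> X 1} := (g' \o f' \- idfun) \- (s \o D 0).
  apply: (@row_lift _ _ _ _ (D 1) h) => x /=.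
  apply/gf_exact; rewrite !mulmxBl g'E f'E sE.
  by rewrite -addrA -opprD subrKC subrr.
exists f, f', g, g', s, s'; split=> // x.
by rewrite s'E subrKC.
Qed.

Lemma homotopyS i : local_homotopy i -> local_homotopy i.+1.
Proof.
move=> [f [f' [g [g' [s [s' [Ff' f'E g'E s'E]]]]]]].
have [g'' g''E] := lift_to_freeS g'E.
have [x|f'' Ff'' f''E] := PhiS Ff'.
  by apply/pr_exact; rewrite f'E gf_diffK linear0.
have [s'' s''E] : exists s'' : {linear X i.+2 -> X i.+3},
    forall x, s'' x *d i.+2 = g'' (f'' x) - x - s' (x *d i.+1).
  pose h : {linear X i.+2 -> X i.+2} := (g'' \o f'' \- idfun) \- (s' \o D i.+1).
  apply: (@row_lift _ _ _ _ (D i.+2) h) => x /=.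
  apply/gf_exact; rewrite !mulmxBl g''E f''E s'E gf_diffK linear0 add0r.
  by rewrite subrr.
exists f', f'', g', g'', s', s''; split=> // x.
by rewrite s''E subrKC.
Qed.

Hypothesis Fmin : gf_minimal F.

Lemma minimal_mulmx i (x : X i.+1) c : ((x *d i) 0 c)@_0 = 0.
Proof.
rewrite mxE raddf_sum /= big1 // => r _.
by rewrite (rmorphM (mcoeff 0%MM)) /= Fmin mulr0.
Qed.

Lemma minimal_linear i j (s : {linear X i -> X j}) (x : X i.+1) c :
  ((s (x *d i)) 0 c)@_0 = 0.
Proof.
rewrite row_linear_comb summxE raddf_sum /= big1 // => r _.
by rewrite mxE (rmorphM (mcoeff 0%MM)) /= minimal_mulmx mul0r.
Qed.

(** The homotopy writes g f - id as a sum of terms whose coordinates have no constant term, by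
    minimality of [F]; [Y] is an arbitrary projective resolution. *)
Lemma minimal_split_injection i :
  exists (f : {linear X i -> pr_mod Y i}) (g : {linear pr_mod Y i -> X i}),
    Phi f /\ forall x c, (g (f x) 0 c)@_0 = (x 0 c)@_0.
Proof.
have [[f [g [s [Ff sE]]]] H0] := homotopy0; case: i => [|i].
  exists f, g; split=> // x c; apply/eqP; rewrite -subr_eq0 -mcoeffB.
  have -> : g (f x) 0 c - x 0 c = (g (f x) - x) 0 c by rewrite !mxE.
  by rewrite sE minimal_mulmx.
have {H0} : local_homotopy i by elim: i => // i; apply: homotopyS.
move=> [_ [f' [_ [g' [s' [s'' [Ff' _ _ s''E]]]]]]].
exists f', g'; split=> // x c; apply/eqP; rewrite -subr_eq0 -mcoeffB.
have -> : g' (f' x) 0 c - x 0 c = (g' (f' x) - x) 0 c by rewrite !mxE.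
by rewrite s''E mxE mcoeffD minimal_mulmx minimal_linear addr0.
Qed.

End Comparison.

(** * Length and shifts of minimal graded resolutions *)

Section FreeResolution.
Variables (k : fieldType) (n : nat).
Local Notation R := {mpoly k[n]}.
Variables (M : lmodType R) (gr : int -> M -> Prop).

Definition free_projective_resolution (G : graded_free_resolution gr) :
  projective_resolution M :=
  @ProjectiveResolution R M (fun i => 'rV_(gf_rank G i))
    (fun i => mulmxr (gf_diff G i) : {linear _ -> _}) (gf_aug G)
    (fun i => @row_projective R _) (@gf_aug_surj _ _ _ _ G)
    (@gf_aug_exact _ _ _ _ G) (@gf_exact _ _ _ _ G).

Lemma minimal_length_le (F : graded_free_resolution gr)
    (Y : projective_resolution M) e i :
  gf_minimal F -> pr_length_le Y e -> (0 < gf_rank F i)%N -> (i <= e)%N.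
Proof.
move=> Fmin Ye ri; rewrite leqNgt; apply/negP => ei.
pose Phi j (f : {linear 'rV[R]_(gf_rank F j) -> pr_mod Y j}) := True.
have [||f [g [_ gfE]]] := minimal_split_injection (Phi := Phi) _ _ Fmin i.
- have [x|f fE] := @row_lift _ _ _ _ (pr_aug Y) (gf_aug F); last by exists f.
  exact: pr_aug_surj.
- move=> j f _ fE.
  have [//|h hE] := @row_lift _ _ _ _ (pr_diff Y j) (f \o mulmxr (gf_diff F j)).
  by exists h.
(* [Y] vanishes in degree [i], so g f kills a basis vector, although it is the identity modulo the
   variables. *)
have /eqP := gfE (delta_mx 0 (Ordinal ri)) (Ordinal ri).
rewrite (Ye _ ei (f _)) linear0 !mxE !eqxx mcoeff0 mcoeff1 eqxx.
by rewrite eq_sym oner_eq0.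
Qed.

(** The coefficient form treats both signs of [d] alike: no monomial has negative degree, so for
    [d < 0] it forces [p = 0]. *)
Lemma homog_degP d (p : R) :
  homog_deg d p <-> forall m, (mdeg m)%:Z != d -> p@_m = 0.
Proof.
case: d => [d|d] /=; split.
- by move=> pd m; rewrite eqz_nat; apply: (dhomog_nemf_coeff pd).
- move=> pd; apply/dhomogP => m; rewrite mcoeff_msupp => pm.
  by apply/eqP; apply: contraNT pm => md; apply/eqP/pd; rewrite eqz_nat.
- by move=> -> m _; rewrite mcoeff0.
- by move=> pd; apply/mpolyP => m; rewrite mcoeff0 pd.
Qed.

Definition hcomp (d : int) (p : R) : R :=
  \sum_(m <- msupp p | (mdeg m)%:Z == d) p@_m *: 'X_[m].

Lemma mcoeff_hcomp d p m :
  (hcomp d p)@_m = if (mdeg m)%:Z == d then p@_m else 0.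
Proof.
rewrite raddf_sum /=; case: ifP => md; last first.
  rewrite big1 // => u ud; rewrite mcoeffZ mcoeffX.
  by have [um|_] := eqVneq u m; [rewrite -um ud in md | rewrite mulr0].
rewrite [in RHS](mpolyE p) [RHS]raddf_sum /= big_mkcond /=.
apply: eq_bigr => u _; case: ifPn => // ud; rewrite mcoeffZ mcoeffX.
by have [um|_] := eqVneq u m; [rewrite um md in ud | rewrite mulr0].
Qed.

Lemma hcomp_homog d p : homog_deg d (hcomp d p).
Proof. by apply/homog_degP => m md; rewrite mcoeff_hcomp (negPf md). Qed.

Lemma hcomp_id d p : homog_deg d p -> hcomp d p = p.
Proof.
move/homog_degP => pd; apply/mpolyP => m; rewrite mcoeff_hcomp.
by case: ifPn => // /pd ->.
Qed.

Lemma hcomp_sum d (I : finType) (p : I -> R) :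
  hcomp d (\sum_i p i) = \sum_i hcomp d (p i).
Proof.
apply/mpolyP => m; rewrite mcoeff_hcomp !(raddf_sum (mcoeff m)) /=.
rewrite [RHS](eq_bigr _ (fun i _ => mcoeff_hcomp d (p i) m)).
by case: ifP => // _; rewrite big1.
Qed.

Lemma hcompM d e p q : homog_deg e q -> hcomp (d + e) (p * q) = hcomp d p * q.
Proof.
move=> /homog_degP qe; apply/mpolyP => m; rewrite mcoeff_hcomp !mcoeffM.
case: ifPn => md; last rewrite big1 //.
  apply: eq_bigr => -[u v] /= /eqP.
  move: (bmnm u) (bmnm v) => {}u {}v mE; rewrite mcoeff_hcomp.
  have [ve|/qe ->] := eqVneq (mdeg v)%:Z e; last by rewrite !mulr0.
  by move: md; rewrite mE mdegD PoszD ve (inj_eq (addIr _)) => ->.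
move=> [u v] /= /eqP; move: (bmnm u) (bmnm v) => {}u {}v mE;
  rewrite mcoeff_hcomp.
have [ve|/qe ->] := eqVneq (mdeg v)%:Z e; last by rewrite !mulr0.
by move: md; rewrite mE mdegD PoszD ve (inj_eq (addIr _)) => /negPf->;
  rewrite mul0r.
Qed.

Lemma homog_degM d e (p q : R) : homog_deg d p -> homog_deg e q ->
  homog_deg (d + e) (p * q).
Proof.
by move=> /hcomp_id <- /hcompM <-; apply: hcomp_homog.
Qed.

Lemma homog_deg_sum d (I : finType) (p : I -> R) :
  (forall i, homog_deg d (p i)) -> homog_deg d (\sum_i p i).
Proof.
move=> pd; have -> : \sum_i p i = hcomp d (\sum_i p i).
  by rewrite hcomp_sum; apply: eq_bigr => i _; rewrite hcomp_id.
exact: hcomp_homog.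
Qed.

Variables F G : graded_free_resolution gr.

(** This is homogeneity of degree 0 for a map between direct sums of shifted copies of R, read off
    the matrix entries. *)
Definition graded_map i (f : 'rV[R]_(gf_rank F i) -> 'rV[R]_(gf_rank G i)) :=
  forall r c, homog_deg (gf_shift (g := F) r - gf_shift (g := G) c)
                (f (delta_mx 0 r) 0 c).

(** Take any preimages of the images of the basis vectors and keep in each coordinate only the
    component of the required degree. Since the differential and the target are homogeneous, the
    truncated vectors are still preimages. *)
Lemma graded_lift i
    (f : {linear 'rV[R]_(gf_rank F i) -> 'rV[R]_(gf_rank G i)}) :
    graded_map f ->
    (forall x, exists y, y *m gf_diff G i = f (x *m gf_diff F i)) ->
  exists2 f' : {linear 'rV[R]_(gf_rank F i.+1) -> 'rV[R]_(gf_rank G i.+1)},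
    graded_map f' & forall x, f' x *m gf_diff G i = f (x *m gf_diff F i).
Proof.
move=> fgr fE; have /choice[y yE] r := fE (delta_mx 0 r).
pose y' r : 'rV[R]_(gf_rank G i.+1) :=
  \row_c hcomp (gf_shift (g := F) r - gf_shift (g := G) c) (y r 0 c).
have [f' f'E] := row_linear_ex y'; exists f'.
  by move=> r c; rewrite f'E mxE; apply: hcomp_homog.
apply: (@row_linear_eq _ _ _ (mulmxr (gf_diff G i) \o f')
          (f \o mulmxr (gf_diff F i))) => r /=.
rewrite f'E; apply/rowP => c.
have hom : homog_deg (gf_shift (g := F) r - gf_shift (g := G) c)
    (f (delta_mx 0 r *m gf_diff F i) 0 c).
  rewrite row_linear_comb summxE; apply: homog_deg_sum => s; rewrite mxE.
  rewrite -rowE mxE -(subrKA (gf_shift (g := F) s)).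
  by apply: homog_degM; [apply: gf_diff_homog | apply: fgr].
rewrite -(hcomp_id hom) -yE !mxE hcomp_sum; apply: eq_bigr => s _.
by rewrite mxE -(hcompM _ _ (gf_diff_homog s c)) subrKA.
Qed.

(** If no shift of [G] equals that of [r], every coordinate of f(e_r) is homogeneous of nonzero
    degree, so g(f(e_r)) has no constant terms, against g f being the identity modulo the
    variables. *)
Lemma minimal_shift_mem i (r : 'I_(gf_rank F i)) :
    gf_minimal F ->
    (exists2 f : {linear 'rV[R]_(gf_rank F 0) -> 'rV[R]_(gf_rank G 0)},
       graded_map f & forall x, gf_aug G (f x) = gf_aug F x) ->
  exists c : 'I_(gf_rank G i), gf_shift (g := F) r = gf_shift (g := G) c.
Proof.
move=> Fmin f0.
pose Y := free_projective_resolution G.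
pose Phi j (f : {linear 'rV[R]_(gf_rank F j) -> pr_mod Y j}) := graded_map f.
have [||f [g [fgr gfE]]] := minimal_split_injection (Phi := Phi) _ _ Fmin i.
- exact: f0.
- by move=> j f; apply: graded_lift.
apply: contrapT => nex; have /eqP := gfE (delta_mx 0 r) r.
rewrite (row_linear_comb g) summxE raddf_sum /= big1.
  by rewrite mxE !eqxx mcoeff1 eqxx eq_sym oner_eq0.
move=> c _; rewrite mxE (rmorphM (mcoeff 0%MM)) /=.
have /homog_degP -> := fgr r c; first by rewrite mul0r.
by rewrite mdeg0 eq_sym subr_eq0; apply/eqP => rc; apply: nex; exists c.
Qed.

End FreeResolution.

(** * The complex of pairs A < B *)

Section Incidence.
Variables (k : fieldType) (n : nat).
Local Notation vertex := (bool * 'I_n)%type.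
Implicit Types (S T : {set vertex}) (e t : vertex).

(* (false, i) stands for x_i and (true, j) for x_j ^ w_j; a cell is a pair of
   nonempty sets A < B of indices, flattened to one set of tagged indices. *)
Definition valid S : bool :=
  [&& [exists i, (false, i) \in S], [exists j, (true, j) \in S] &
      [forall i : 'I_n, forall j : 'I_n,
         ((false, i) \in S) && ((true, j) \in S) ==> (i < j)%N]].

Lemma validP S : reflect
  [/\ exists i, (false, i) \in S, exists j, (true, j) \in S &
      forall i j, (false, i) \in S -> (true, j) \in S -> (i < j)%N]
  (valid S).
Proof.
apply: (iffP and3P) => [[/existsP xS /existsP yS /forallP SP]|[xS yS SP]].
  by split=> // i j iS jS; have /forallP/(_ j)/implyP -> := SP i; rewrite ?iS.
split; [exact/existsP | exact/existsP |].
by apply/forallP => i; apply/forallP => j; apply/implyP => /andP[]; apply: SP.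
Qed.

(** The empty face is the basis element in homological degree 0. *)
Definition cell S := (S == set0) || valid S.

(** A linear order on vertices with all x-tags before all y-tags; it fixes the Koszul signs. *)
Definition key e : nat := (if e.1 then n + e.2 else e.2)%N.

Lemma key_inj : injective key.
Proof.
case=> [] [] i [] [] j; rewrite /key /= => E.
- by congr (_, _); apply/val_inj/(@addnI n).
- by have := ltn_ord j; rewrite -E ltnNge leq_addr.
- by have := ltn_ord i; rewrite E ltnNge leq_addr.
- by congr (_, _); apply/val_inj.
Qed.

Lemma key_lt e t : ~~ e.1 -> t.1 -> (key e < key t)%N.
Proof.
by rewrite /key => /negPf-> ->; rewrite (leq_trans (ltn_ord _)) ?leq_addr.
Qed.

Definition sg S e : k := (-1) ^+ #|[set t in S | (key t < key e)%N]|.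

Lemma sg_neq0 S e : sg S e != 0.
Proof. by rewrite signr_eq0. Qed.

Lemma sg_del_gt S e t : (key e < key t)%N -> sg (S :\ t) e = sg S e.
Proof.
move=> et; rewrite /sg; congr (_ ^+ #|pred_of_set _|); apply/setP => s.
rewrite !inE; case: (eqVneq s t) => [->|//].
by rewrite ltnNge (ltnW et) /= andbF.
Qed.

Lemma sg_del_lt S e t : e \in S -> (key e < key t)%N ->
  sg (S :\ e) t = - sg S t.
Proof.
move=> eS et; rewrite /sg.
have -> : [set s in S | (key s < key t)%N] =
    e |: [set s in S :\ e | (key s < key t)%N].
  apply/setP => s; rewrite !inE; case: (eqVneq s e) => [->|//].
  by rewrite eS et.
by rewrite cardsU1 !inE eqxx /= exprS mulN1r opprK.
Qed.

Lemma sg_adjacent S e t : e \in S -> (key e < key t)%N ->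
  (forall s, s \in S -> (key e < key s)%N -> (key t <= key s)%N) ->
  sg S t = - sg S e.
Proof.
move=> eS et adj; rewrite /sg.
have -> : [set s in S | (key s < key t)%N] =
    e |: [set s in S | (key s < key e)%N].
  apply/setP => s; rewrite !inE; case: (eqVneq s e) => [->|se].
    by rewrite eS et.
  case sS: (s \in S) => //=; apply/idP/idP => [st|/ltn_trans->//].
  rewrite ltn_neqAle (inj_eq key_inj) se /= leqNgt; apply/negP => /(adj _ sS).
  by rewrite leqNgt st.
by rewrite cardsU1 !inE ltnn andbF /= exprS mulN1r.
Qed.

(** Deleting one element of a pair never gives the empty set, so the map from degree 1 to degree 0
    has its own clause. In the other clause at most one [e] contributes. *)
Definition inc S T : k :=
  if T == set0 then (valid S && (#|S| == 2%N))%:R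
  else \sum_(e in S | S :\ e == T) sg S e.

Lemma inc0l T : inc set0 T = 0.
Proof.
rewrite /inc; case: ifP => _; first by rewrite cards0 andbF.
by rewrite big1 // => e; rewrite inE.
Qed.

Lemma inc0r S : inc S set0 = (valid S && (#|S| == 2%N))%:R.
Proof. by rewrite /inc eqxx. Qed.

Lemma inc_del S e : e \in S -> S :\ e != set0 -> inc S (S :\ e) = sg S e.
Proof.
move=> eS /negPf S0; rewrite /inc S0 (bigD1 e) ?eS /=; last by rewrite eqxx.
rewrite big1 ?addr0 // => t /andP[/andP[tS /eqP E] te].
by have := setD11 t S; rewrite E !inE te tS.
Qed.

Lemma inc_neq0_del S T :
  inc S T != 0 -> T != set0 -> exists2 e, e \in S & T = S :\ e.
Proof.
move=> ST T0; have [/exists_inP[e eS /eqP]|/exists_inPn nST] :=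
  boolP [exists e in S, T == S :\ e]; first by exists e.
case/negP: ST; rewrite /inc (negPf T0) big_pred0 // => e.
by apply/andP => -[/nST]; rewrite eq_sym => /negPf->.
Qed.

Lemma inc_neq0_sub S T : inc S T != 0 -> T \subset S.
Proof.
have [->|T0] := eqVneq T set0; first by rewrite sub0set.
by move=> /inc_neq0_del/(_ T0)[e _ ->]; apply: subD1set.
Qed.

Lemma inc_neq0_card0 S : inc S set0 != 0 -> valid S /\ #|S| = 2%N.
Proof.
by rewrite inc0r; case: (boolP (_ && _)) => [/andP[-> /eqP]|]; rewrite ?eqxx.
Qed.

Lemma valid_neq0 S : valid S -> S != set0.
Proof. by case/validP => -[i iS] _ _; apply/set0Pn; exists (false, i). Qed.

Lemma valid_card_gt1 S : valid S -> (1 < #|S|)%N.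
Proof.
case/validP => -[i iS] [j jS] _; rewrite -(cards2 (false, i) (true, j)).
by apply/subset_leq_card/subsetP => e; rewrite !inE => /orP[] /eqP->.
Qed.

(** [#|S|.-1] is the homological degree. It is 0 on the empty face, so the step from a pair to the
    empty face also lowers it by one. *)
Lemma inc_neq0_card S T : cell S -> cell T -> inc S T != 0 ->
  #|S|.-1 = #|T|.-1.+1.
Proof.
move=> _ /orP[/eqP->|vT] ST.
  by have [_ ->] := inc_neq0_card0 ST; rewrite cards0.
have [e eS TE] := inc_neq0_del ST (valid_neq0 vT).
by have := valid_card_gt1 vT; rewrite (cardsD1 e S) eS -TE; case: #|T|.
Qed.

Lemma valid_between S T S' : valid S -> valid T ->
  T \subset S' -> S' \subset S -> valid S'.
Proof.
move=> /validP[_ _ SP] /validP[[i iT] [j jT] _] TS' S'S; apply/validP; split.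
- by exists i; apply: (subsetP TS').
- by exists j; apply: (subsetP TS').
- by move=> a b /(subsetP S'S) aS /(subsetP S'S); apply: SP.
Qed.

(** The order condition is inherited by subsets; only nonemptiness of the part containing [e] is at
    stake. *)
Lemma valid_del S e : valid S ->
  valid (S :\ e) = [exists t in S, (t != e) && (t.1 == e.1)].
Proof.
move=> vS; have [[i iS] [j jS] SP] := validP _ vS.
apply/idP/exists_inP => [/validP[[a aS] [b bS] _]|[t tS /andP[te t1]]].
  by case: e aS bS => [[] c] aS bS;
    [exists (true, b) | exists (false, a)];
    move: aS bS; rewrite !inE ?andbT => /andP[? ?] /andP[? ?] //; apply/andP.
apply/validP; split; last by move=> a b /setD1P[_ aS] /setD1P[_]; apply: SP.
- case: e te t1 => [[] c] te t1; first by exists i; rewrite !inE iS.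
  by case: t t1 te tS => [[] d] // _ te tS; exists d; rewrite !inE te.
- case: e te t1 => [[] c] te t1; last by exists j; rewrite !inE jS.
  by case: t t1 te tS => [[] d] // _ te tS; exists d; rewrite !inE te.
Qed.

(** Split by which of [e] and [t] has the smaller key, then exchange the two variables in one
    half. *)
Lemma antisym_sum (Q : rel vertex) (K : vertex -> vertex -> k) :
    ssrbool.symmetric Q ->
    (forall e t, Q e t -> (key e < key t)%N -> K e t + K t e = 0) ->
  \sum_e \sum_(t | (t != e) && Q e t) K e t = 0.
Proof.
move=> Qs KP; pose L e t := (key e < key t)%N && Q e t.
have -> : \sum_e \sum_(t | (t != e) && Q e t) K e t =
    \sum_e (\sum_(t | L e t) K e t + \sum_(t | L t e) K e t).
  apply: eq_bigr => e _; rewrite (bigID (fun t => (key e < key t)%N)) /=.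
  congr (_ + _); apply: eq_bigl => t; rewrite /L -(inj_eq key_inj);
    case: (ltngtP (key e) (key t)) => _ /=; rewrite ?andbT ?andbF //.
rewrite big_split /= [X in _ + X](exchange_big_dep predT) //= -big_split /=.
rewrite big1 // => e _; rewrite -big_split /= big1 // => t /andP[et Qet].
exact: KP.
Qed.

Lemma inc_inc S T : cell S -> cell T ->
  \sum_(S' | cell S') inc S S' * inc S' T = 0.
Proof.
move=> /orP[/eqP->|vS] cT; first by rewrite big1 // => S' _;
  rewrite inc0l mul0r.
have -> : \sum_(S' | cell S') inc S S' * inc S' T =
    \sum_(e in S | valid (S :\ e)) sg S e * inc (S :\ e) T.
  rewrite (bigD1 set0) /= ?/cell ?eqxx // inc0l mulr0 add0r.
  rewrite (eq_bigl valid); last first.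
    move=> S'; case: eqP => [->|_] /=; last by rewrite andbT.
    by apply/esym/negP => /valid_neq0; rewrite eqxx.
  transitivity (\sum_(S' | valid S') \sum_(e in S | S :\ e == S')
                   sg S e * inc S' T).
    apply: eq_bigr => S' vS'; rewrite /inc (negPf (valid_neq0 vS')).
    by rewrite mulr_suml.
  rewrite (exchange_big_dep (fun e => (e \in S) && valid (S :\ e))) /=;
    last first.
    by move=> S' e vS' /andP[-> /eqP->].
  apply: eq_bigr => e /andP[eS vSe]; rewrite (big_pred1 (S :\ e)) // => S'.
  by rewrite eS /= eq_sym; case: eqP => [->|]; rewrite ?vSe ?andbF.
(* For valid [T] the two orders of deletion cancel; the intermediate sets are automatically valid,
   lying between [T] and [S]. *)
case/orP: cT => [/eqP->|vT]; last first.
  transitivity (\sum_e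
      \sum_(t | (t != e) && [&& e \in S, t \in S & S :\ e :\ t == T])
                 sg S e * sg (S :\ e) t).
    rewrite big_mkcond /=; apply: eq_bigr => e _;
      case: ifPn => [/andP[eS vSe]|nSe].
      rewrite /inc (negPf (valid_neq0 vT)) mulr_sumr; apply: eq_bigl => t.
      by rewrite !inE eS /= andbA.
    rewrite big_pred0 // => t; apply/negP => /and4P[te eS tS /eqP ET].
    case/negP: nSe; rewrite eS (valid_between vS vT) ?subD1set //.
    by rewrite -ET subD1set.
  apply: antisym_sum => [e t|e t /and3P[eS tS _] et].
    by rewrite !setDDl setUC andbCA.
  by rewrite (sg_del_lt eS et) (sg_del_gt S et) mulrN addrC mulrC subrr.
have cS e : e \in S -> #|S| = #|S :\ e|.+1 by move=> eS; rewrite (cardsD1 e) eS.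
(* For empty [T] the middle cell must be a pair, so only triples [S] matter. *)
have [S3|S3] := eqVneq #|S| 3%N; last first.
  rewrite big1 // => e /andP[/cS E _]; rewrite inc0r.
  by rewrite E eqSS in S3; rewrite (negPf S3) andbF mulr0.
rewrite (eq_bigr (sg S)) => [|e /andP[/cS]]; last first.
  by rewrite S3 => -[E] vSe; rewrite inc0r vSe -E mulr1.
have [[i iS] [j jS] SP] := validP _ vS.
pose X b := [set e in S | e.1 == b].
have XS : (#|X false| + #|X true| = 3)%N.
  rewrite -S3 -(cardsID [set e : vertex | ~~ e.1] S).
  by congr (_ + _)%N; apply: eq_card => -[[] a]; rewrite !inE ?andbT ?andbF.
have X0 : (0 < #|X false|)%N by apply/card_gt0P; exists (false, i);
  rewrite !inE iS.
have X1 : (0 < #|X true|)%N by apply/card_gt0P; exists (true, j);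
  rewrite !inE jS.
(* [b] is the tag occurring twice in the triple. Exactly its two bearers [x] and [y] can be
   deleted. *)
have [b /eqP/cards2P[x [y [xy XE]]] /eqP/cards1P[z Xz]] :
    exists2 b, #|X b| = 2%N & #|X (~~ b)| = 1%N.
  case E: #|X true| X1 XS => [|[|[|t]]] // _; rewrite !addnS ?addn0 => -[].
  - by move=> ?; exists false.
  - by move=> ?; exists true.
  - by move/eqP; rewrite addn_eq0 => /andP[/eqP E0]; rewrite E0 in X0.
wlog lxy : x y xy XE / (key x < key y)%N => [wl|].
  case: (ltngtP (key x) (key y)) => [||/key_inj E]; first exact: wl.
    by apply: wl; rewrite 1?eq_sym // setUC.
  by rewrite E eqxx in xy.
have memX e : e \in S -> (e.1 == b) = (e == x) || (e == y).
  by move=> eS; rewrite -in_set2 -XE inE eS.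
have xS : x \in S by have := set21 x y; rewrite -XE inE => /andP[].
have yS : y \in S by have := set22 x y; rewrite -XE inE => /andP[].
have xb : x.1 = b by apply/eqP; rewrite memX // eqxx.
have yb : y.1 = b by apply/eqP; rewrite memX // eqxx orbT.
rewrite (eq_bigl (mem [set x; y])) => [|e]; last first.
  rewrite /= in_set2; case eS: (e \in S) => /=; last first.
    by apply/esym/negP => /orP[] /eqP E; rewrite E ?xS ?yS in eS.
  rewrite valid_del // -memX //;
    apply/exists_inP/eqP => [[t tS /andP[te t1]]|eb].
    apply/eqP; apply: contraNT te => eb.
    have Xz' u : u \in S -> u.1 != b -> u = z.
      move=> uS ub; apply/eqP; rewrite -in_set1 -Xz inE uS /=.
      by move: ub; case: (u.1); case: (b).
    by rewrite (Xz' t tS) ?(eqP t1) // (Xz' e eS).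
  have := memX e eS; rewrite eb eqxx => /esym/orP[]/eqP->.
    by exists y; rewrite ?xb ?yb ?eqxx ?andbT // eq_sym.
  by exists x; rewrite ?xb ?yb ?eqxx ?andbT.
(* The third element has the other tag, so its key is not between those of [x] and [y]; these are
   adjacent and have opposite signs. *)
rewrite big_setU1 ?inE //= big_set1 (sg_adjacent xS lxy) ?subrr //.
move=> s sS xs; have := memX s sS; case: eqP => [_ /esym/orP[]/eqP E|sb _].
- by rewrite E ltnn in xs.
- by rewrite E.
case bE: b; rewrite bE in xb yb sb; last first.
  by rewrite ltnW // key_lt // ?yb //; case: (s.1) sb.
have : (key s < key x)%N by rewrite key_lt ?xb //; case: (s.1) sb.
by rewrite ltnNge (ltnW xs).
Qed.

End Incidence.

(** * Exactness over the field by elimination along matchings *)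

Section Exactness.
Variables (k : fieldType) (n : nat).
Local Notation vertex := (bool * 'I_n)%type.
Local Notation cells := (@cell n).
Local Notation inc := (@inc k n).
Implicit Types (S T : {set vertex}) (f g : {set vertex} -> k).

Definition bd f T : k := \sum_(S | cell S) f S * inc S T.

Definition cycle f := forall T, cell T -> bd f T = 0.

Section Eliminate.
Variables (f : {set vertex} -> k) (Q : pred {set vertex}).
Variable mu : {set vertex} -> {set vertex}.

(** All matched pairs are treated at once: the boundary of the chain with coefficient
    [f S / inc (mu S) S] on each [mu S] is subtracted, in order to clear [f] on [Q]. *)
Definition eliminate T : k :=
  f T - \sum_(S | Q S) f S / inc (mu S) S * inc (mu S) T.

Hypothesis cell_mu : forall S, Q S -> cell (mu S).

Lemma eliminate_bd : exists2 g, (forall T, f T - eliminate T = bd g T) &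
  forall T, (forall S, Q S -> mu S != T) -> g T = 0.
Proof.
exists (fun T => \sum_(S | Q S) (mu S == T)%:R * (f S / inc (mu S) S)) => T;
  last by move=> QT; rewrite big1 // => S /QT/negPf->; rewrite mul0r.
rewrite /eliminate opprB addrC subrK /bd.
under [RHS]eq_bigr do rewrite mulr_suml.
rewrite exchange_big /=; apply: eq_bigr => S QS.
rewrite (bigD1 (mu S)) ?cell_mu //= eqxx mul1r big1 ?addr0 // => S' /andP[_].
by rewrite eq_sym => /negPf->; rewrite !mul0r.
Qed.

Lemma eliminate_cycle : cycle f -> cycle eliminate.
Proof.
move=> fc T cT; rewrite /bd.
under eq_bigr do rewrite mulrBl mulr_suml.
rewrite sumrB [X in X - _]fc // sub0r exchange_big /= big1 ?oppr0 // => S QS.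
under eq_bigr do rewrite -!mulrA.
by rewrite -!mulr_sumr inc_inc ?mulr0 // cell_mu.
Qed.

Lemma eliminateE T : (forall S, Q S -> inc (mu S) T = 0) -> eliminate T = f T.
Proof.
by move=> QT; rewrite /eliminate big1 ?subr0 // => S /QT->; rewrite mulr0.
Qed.

Lemma eliminate_eq0 T : Q T -> inc (mu T) T != 0 ->
  (forall S, Q S -> inc (mu S) T != 0 -> S = T) -> eliminate T = 0.
Proof.
move=> QT T0 QP; rewrite /eliminate (bigD1 T) //= divfK //
  big1 ?addr0 ?subrr //.
move=> S /andP[QS ST]; have [->|/QP E] := eqVneq (inc (mu S) T) 0.
  by rewrite mulr0.
by rewrite E ?eqxx in ST.
Qed.

End Eliminate.

(** The boundary at [T] reduces to the single term [f S * inc S T]. *)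
Lemma cycle_eq0 f S T : cycle f -> cell S -> cell T -> inc S T != 0 ->
  (forall S', cell S' -> f S' != 0 -> inc S' T != 0 -> S' = S) -> f S = 0.
Proof.
move=> fc cS cT ST uniqS; apply/eqP; have /eqP := fc T cT.
rewrite /bd (bigD1 S) //= big1 ?addr0 ?mulf_eq0 ?(negPf ST) ?orbF //.
move=> S' /andP[cS' S'S]; apply/eqP; apply: contraNT S'S.
by rewrite mulf_eq0 negb_or => /andP[f0 i0]; rewrite (uniqS S').
Qed.

Section Contraction.
Variables (E : {set vertex}) (v u : 'I_n).
Hypotheses (vE : (false, v) \in E) (uE : (true, u) \in E) (vu : (v < u)%N).
Hypothesis v_min : forall i, (false, i) \in E -> (v <= i)%N.

Local Notation xv := (false, v).
Local Notation yu := (true, u).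

Definition lacks_xv S := [&& valid S, S \subset E & xv \notin S].
Definition add_xv S := xv |: S.

Definition only_xv S := forall i, (false, i) \in S -> i = v.
(** For valid [S] containing x_v, non-validity of [S :\ xv] says that x_v is its only x-tag. The
    empty face joins this matching with partner {x_v, y_u}, since {y_u} is not a cell. *)
Definition lacks_yu S := (S == set0) ||
  [&& valid S, S \subset E, ~~ valid (S :\ xv), xv \in S & yu \notin S].
Definition add_yu S := if S == set0 then [set xv; yu] else yu |: S.

Lemma valid_add_xv S : lacks_xv S -> valid (add_xv S).
Proof.
case/and3P => /validP[[i iS] [j jS] SP] SE _; apply/validP; split.
- by exists v; rewrite setU11.
- by exists j; rewrite !inE jS orbT.
- move=> a b; rewrite !inE /= ?orbF => /orP[/eqP[->]|aS] bS; last exact: SP.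
  by rewrite (leq_ltn_trans _ (SP _ _ iS bS)) // v_min // (subsetP SE).
Qed.

Lemma valid_xy : valid [set xv; yu].
Proof.
apply/validP; split; [by exists v; rewrite set21|by exists u; rewrite set22|].
by move=> a b; rewrite !inE /= ?orbF => /eqP[->] /eqP[->].
Qed.

Lemma only_xvP S : valid S -> xv \in S -> ~~ valid (S :\ xv) -> only_xv S.
Proof.
move=> vS vSx; rewrite valid_del // => /exists_inPn nS i iS.
by have := nS _ iS; rewrite andbT negbK => /eqP[].
Qed.

Lemma lacks_yu_only S : lacks_yu S -> only_xv (add_yu S).
Proof.
rewrite /add_yu => /orP[->|/and5P[vS _ nvS xS _]] i.
  by rewrite !inE /= ?orbF => /eqP[].
rewrite (negPf (valid_neq0 vS)) !inE /=; exact: only_xvP.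
Qed.

Lemma add_yu_yu S : yu \in add_yu S.
Proof. by rewrite /add_yu; case: ifP; rewrite !inE eqxx ?orbT. Qed.

Lemma valid_add_yu S : lacks_yu S -> valid (add_yu S).
Proof.
move=> Q2S; have only := lacks_yu_only Q2S; move: only.
rewrite /add_yu; case/orP: Q2S => [->|/and5P[vS _ nvS xS _]] only.
  exact: valid_xy.
move: only; rewrite (negPf (valid_neq0 vS)) => only.
have [_ [j jS] SP] := validP _ vS; apply/validP; split.
- by exists v; rewrite !inE xS orbT.
- by exists j; rewrite !inE jS orbT.
- move=> a b aS; have -> := only a aS; rewrite !inE => /orP[/eqP[->]//|].
  exact: SP.
Qed.

Lemma add_xv_sub S : lacks_xv S -> add_xv S \subset E.
Proof. by case/and3P => _ SE _; rewrite subUset sub1set vE. Qed.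

Lemma add_yu_sub S : lacks_yu S -> add_yu S \subset E.
Proof.
rewrite /add_yu => /orP[->|/and5P[vS SE _ _ _]].
  by rewrite subUset !sub1set vE.
by rewrite (negPf (valid_neq0 vS)) subUset sub1set uE.
Qed.

Variable f : {set vertex} -> k.
Hypothesis fc : cycle f.
Hypothesis fE : forall S, ~~ (S \subset E) -> f S = 0.

(** [f1] is what remains after the matching that adds x_v, [f2] after the one that adds y_u as well;
    the aim is [f2 = 0] on cells. *)
Let f1 := eliminate f lacks_xv add_xv.
Let f2 := eliminate f1 lacks_yu add_yu.

Let cell_add_xv S : lacks_xv S -> cell (add_xv S).
Proof. by move=> /valid_add_xv; rewrite /cell => ->; rewrite orbT. Qed.

Let cell_add_yu S : lacks_yu S -> cell (add_yu S).
Proof. by move=> /valid_add_yu; rewrite /cell => ->; rewrite orbT. Qed.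

Let cell_valid S : valid S -> cell S.
Proof. by rewrite /cell => ->; rewrite orbT. Qed.

Let f1c : cycle f1.
Proof. exact: eliminate_cycle. Qed.

Let f2c : cycle f2.
Proof. exact: eliminate_cycle. Qed.

Lemma inc_setU1 S e : S != set0 -> e \notin S -> inc (e |: S) S != 0.
Proof.
move=> S0 eS; rewrite -{2}(setU1K eS) inc_del ?setU11 ?setU1K //.
exact: sg_neq0.
Qed.

Lemma inc_setU1_eq S T e : T != set0 -> e \notin T -> e \in S ->
  inc S T != 0 -> S = e |: T.
Proof.
move=> T0 eT eS /inc_neq0_del/(_ T0)[t tS TE].
have <- : t = e by apply/eqP; rewrite eq_sym; apply: contraNT eT;
  rewrite TE !inE eS andbT.
by rewrite TE setD1K.
Qed.

Lemma f1E S : ~~ (S \subset E) -> f1 S = 0.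
Proof.
move=> SE; rewrite /f1 eliminateE ?fE // => T /add_xv_sub TE.
by apply/eqP; apply: contraNT SE => /inc_neq0_sub/subset_trans->.
Qed.

Lemma f1_lacks_xv S : lacks_xv S -> f1 S = 0.
Proof.
move=> QS; have /and3P[vS SE xS] := QS; have S0 := valid_neq0 vS.
apply: eliminate_eq0; rewrite // ?inc_setU1 // => T /and3P[_ _ xT] TS.
have := inc_setU1_eq S0 xS (setU11 _ _) TS; rewrite /add_xv.
by move/(congr1 (fun X => X :\ xv)); rewrite !setU1K.
Qed.

(** Look at the boundary at [S]: a cell with face [S] on which [f1] is nonzero must contain x_v,
    hence is [add_xv S]. *)
Lemma f1_add_xv S : lacks_xv S -> f1 (add_xv S) = 0.
Proof.
move=> QS; have /and3P[vS SE xS] := QS; have S0 := valid_neq0 vS.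
apply: (cycle_eq0 (T := S)) => //; first exact: cell_add_xv.
- exact: cell_valid.
- exact: inc_setU1.
move=> T cT fT TS; apply: inc_setU1_eq => //; apply: contraNT fT => xT.
have vT : valid T.
  by case/orP: cT => // /eqP T0; rewrite T0 inc0l eqxx in TS.
have [TE|/f1E->//] := boolP (T \subset E).
by rewrite f1_lacks_xv // /lacks_xv vT TE xT.
Qed.

(** The second elimination only alters faces of sets whose sole x-tag is x_v, so here [f2] agrees
    with [f1], which already vanishes. *)
Lemma f2_not_only S :
  valid S -> (exists2 i, (false, i) \in S & i != v) -> f2 S = 0.
Proof.
move=> vS [i iS iv]; rewrite /f2 eliminateE => [|T /lacks_yu_only only];
  last first.
  apply/eqP; apply: contraNT iv => /inc_neq0_sub/subsetP TS.
  by apply/eqP/only/TS.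
have [SE|/f1E//] := boolP (S \subset E).
have [xS|xS] := boolP (xv \in S);
  last by rewrite f1_lacks_xv // /lacks_xv vS SE xS.
rewrite -(setD1K xS); apply: f1_add_xv; rewrite /lacks_xv setD11 valid_del //.
rewrite (subset_trans (subD1set _ _) SE) !andbT; apply/exists_inP.
by exists (false, i); rewrite // andbT; apply: contraNN iv => /eqP[->].
Qed.

Lemma f2_E S : ~~ (S \subset E) -> f2 S = 0.
Proof.
move=> SE; rewrite /f2 eliminateE ?f1E // => T /add_yu_sub TE.
by apply/eqP; apply: contraNT SE => /inc_neq0_sub/subset_trans->.
Qed.

Lemma inc_add_yu S : lacks_yu S -> inc (add_yu S) S != 0.
Proof.
rewrite /add_yu => /orP[/eqP->|/and5P[vS _ _ _ yS]].
  by rewrite eqxx inc0r valid_xy cards2 /= oner_neq0.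
by rewrite (negPf (valid_neq0 vS)) inc_setU1 // valid_neq0.
Qed.

Lemma add_yu_eq S T : lacks_yu T -> valid S -> yu \in S -> only_xv S ->
  inc S T != 0 -> S = add_yu T.
Proof.
rewrite /add_yu => /orP[/eqP->|/and5P[vT _ _ _ yT]] vS yS only ST; last first.
  by rewrite (negPf (valid_neq0 vT)); apply: inc_setU1_eq => //;
    apply: valid_neq0.
rewrite eqxx; apply/esym/eqP; rewrite eqEcard cards2 /=.
have [_ ->] := inc_neq0_card0 ST; rewrite andbT subUset !sub1set yS andbT.
by have [[i iS] _ _] := validP _ vS; rewrite -{1}(only i iS).
Qed.

Lemma f2_lacks_yu S : lacks_yu S -> f2 S = 0.
Proof.
move=> QS; apply: eliminate_eq0 => //; first exact: inc_add_yu.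
move=> T QT TS; have E2 : add_yu T = add_yu S.
  by apply: add_yu_eq => //;
    [apply: valid_add_yu | apply: add_yu_yu | apply: lacks_yu_only].
(* An explicit inverse of [add_yu]: a nonempty [X] has a y-tag other than y_u, so only the empty
   face goes to {x_v, y_u}. *)
have add_yuK X : lacks_yu X ->
    X = (if add_yu X == [set xv; yu] then set0 else add_yu X :\ yu).
  rewrite /add_yu => /orP[/eqP->|/and5P[vX _ _ xX yX]]; first by rewrite !eqxx.
  rewrite (negPf (valid_neq0 vX)) setU1K //; case: eqP => // XE.
  have [_ [j jX] _] := validP _ vX.
  have : (true, j) \in [set xv; yu] by rewrite -XE !inE jX orbT.
  by rewrite !inE /= => /eqP[jE]; rewrite jE (negPf yX) in jX.
by rewrite (add_yuK T) // E2 -add_yuK.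
Qed.

(** A cell not yet cleared has x_v as only x-tag and contains y_u, so it is [add_yu T]. The other
    cells having [T] as a face are cleared, and the cycle condition at [T] finishes. *)
Lemma f2_eq0 S : cell S -> f2 S = 0.
Proof.
case/orP => [/eqP->|vS]; first by rewrite f2_lacks_yu // /lacks_yu eqxx.
have [SE|/f2_E//] := boolP (S \subset E).
have [[i] /andP[iS iv]|only] :=
  pselect (exists i, ((false, i) \in S) && (i != v)).
  by apply: f2_not_only => //; exists i.
have {}only : only_xv S.
  by move=> i iS; apply/eqP/negPn/negP => iv; apply: only; exists i; rewrite iS.
have xS : xv \in S by have [[i iS] _ _] := validP _ vS; rewrite -{1}(only i iS).
have nvx T : T \subset S -> valid T -> ~~ valid (T :\ xv).
  move=> /subsetP TS vT; rewrite valid_del //;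
    apply/exists_inPn => -[[] a] /= //.
  by move=> aS; rewrite andbT negbK (only a) ?TS.
have [yS|yS] := boolP (yu \in S); last first.
  by rewrite f2_lacks_yu // /lacks_yu vS SE xS yS nvx ?orbT.
pose T := if S == [set xv; yu] then set0 else S :\ yu.
have QT : lacks_yu T.
  rewrite /lacks_yu /T; case: ifPn => [_|Sxy]; first by rewrite eqxx.
  have vT : valid (S :\ yu).
    rewrite valid_del //; apply/exists_inP.
    have /subsetPn[[b a] aS] : ~~ (S \subset [set xv; yu]).
      apply: contraNN Sxy => SS; rewrite eqEsubset SS subUset !sub1set xS yS //.
    rewrite !inE negb_or => /andP[ax ay]; exists (b, a) => //=.
    rewrite ay; case: b aS ax {ay} => // /only ->; by rewrite eqxx.
  by rewrite vT setD11 nvx ?subD1set //=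
    (subset_trans (subD1set _ _) SE) !inE xS orbT.
have SE2 : S = add_yu T.
  rewrite /add_yu /T; case: (eqVneq S [set xv; yu]) => [->|Sxy];
    first by rewrite eqxx.
  case: ifPn => [/eqP T0|_]; last by rewrite setD1K.
  by move: QT; rewrite /T (negPf Sxy) => _; move: xS; have := setD1K yS;
    rewrite T0 setU0 => <-; rewrite !inE.
apply: (cycle_eq0 (T := T)) => //; first exact: cell_valid.
- by case/orP: QT => [/eqP->|/and5P[/cell_valid]] //; rewrite /cell eqxx.
- by rewrite SE2 inc_add_yu.
move=> S' cS' fS' S'T; rewrite SE2.
have vS' : valid S'.
  by case/orP: cS' => // /eqP S'0; rewrite S'0 inc0l eqxx in S'T.
have only' : only_xv S'.
  move=> i iS'; apply/eqP; apply: contraNT fS' => iv; apply/eqP.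
  by apply: f2_not_only => //; exists i.
apply: add_yu_eq => //; apply: contraNT fS' => yS'; apply/eqP.
have [S'E|/f2_E//] := boolP (S' \subset E).
have xS' : xv \in S' by have [[i iS'] _ _] := validP _ vS';
  rewrite -{1}(only' i iS').
apply: f2_lacks_yu; rewrite /lacks_yu vS' S'E xS' yS' /=
  andbT orbC valid_del //.
apply/orP; left; apply/exists_inPn => -[[] a] /= //.
by move=> aS; rewrite andbT negbK (only' a).
Qed.

Lemma contraction_exact : exists g, (forall S, ~~ (S \subset E) -> g S = 0) /\
  forall T, cell T -> f T = bd g T.
Proof.
have [g1 g1E g1S] := eliminate_bd f cell_add_xv.
have [g2 g2E g2S] := eliminate_bd f1 cell_add_yu.
exists (fun S => g1 S + g2 S); split=> [S SE|T cT].
  rewrite g1S ?g2S ?addr0 // => T QT; apply: contraNneq SE => <-.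
    exact: add_yu_sub.
  exact: add_xv_sub.
rewrite /bd.
under eq_bigr do rewrite mulrDl.
rewrite big_split /= -[X in X + _]g1E -[X in _ + X]g2E.
by rewrite -/f1 -/f2 f2_eq0 // subr0 subrK.
Qed.

End Contraction.

(** A valid subset of [E] provides a y-index above some x-index, hence above the least one.
    Otherwise the only cell inside [E] is the empty face, where [f] is 0. *)
Lemma bd_exact (E : {set vertex}) f :
    cycle f -> f set0 = 0 -> (forall S, ~~ (S \subset E) -> f S = 0) ->
  exists g, (forall S, ~~ (S \subset E) -> g S = 0) /\
    forall T, cell T -> f T = bd g T.
Proof.
move=> fc f0 fE.
have [[S /andP[vS SE]]|nS] := pselect (exists S, valid S && (S \subset E)).
  have [[i iS] [j jS] SP] := validP _ vS.
  pose v := [arg min_(a < i | (false, a) \in E) a].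
  have [vE v_min] :
      (false, v) \in E /\ forall a, (false, a) \in E -> (v <= a)%N.
    by rewrite /v; case: arg_minnP; rewrite ?(subsetP SE).
  apply: (contraction_exact vE (subsetP SE _ jS)) => //.
  exact: leq_ltn_trans (v_min i (subsetP SE _ iS)) (SP _ _ iS jS).
exists (fun=> 0); split=> // T cT; rewrite /bd.
under eq_bigr do rewrite mul0r.
rewrite big1 //; case/orP: cT => [/eqP->//|vT]; apply: fE.
by apply/negP => TE; apply: nS; exists T; rewrite vT.
Qed.

End Exactness.

(** * The resolution over the polynomial ring *)

Section MonomialComplex.
Variables (k : fieldType) (n : nat) (w : 'I_n -> nat).
Hypothesis w_gt0 : forall i, (0 < w i)%N.
Local Notation R := {mpoly k[n]}.
Local Notation vertex := (bool * 'I_n)%type.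
Local Notation inc := (@inc k n).
Implicit Types (S T : {set vertex}) (e t : vertex) (a m : 'X_{1..n}).

Definition wt e : nat := if e.1 then w e.2 else 1%N.

Definition vdeg e : 'X_{1..n} := (U_(e.2) *+ wt e)%MM.

Definition cdeg S : 'X_{1..n} := (\sum_(e in S) vdeg e)%MM.

Lemma wt_gt0 e : (0 < wt e)%N.
Proof. by rewrite /wt; case: ifP. Qed.

Lemma mdeg_cdeg S : mdeg (cdeg S) = (\sum_(e in S) wt e)%N.
Proof.
by rewrite mdeg_sum; apply: eq_bigr => e _; rewrite mdegMn mdeg1 mul1n.
Qed.

Lemma cdeg0 : cdeg set0 = 0%MM.
Proof. by rewrite /cdeg big_set0. Qed.

Lemma cdeg_sub S T : T \subset S -> (cdeg T <= cdeg S)%MM.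
Proof.
move=> TS; rewrite /cdeg [X in (_ <= X)%MM](big_setID T) /= (setIidPr TS).
exact: lem_addr.
Qed.

Lemma mdeg_cdeg_proper S T : T \proper S -> (mdeg (cdeg T) < mdeg (cdeg S))%N.
Proof.
case/properP => TS [e eS eT]; rewrite !mdeg_cdeg [ltnRHS](big_setID T) /=.
rewrite (setIidPr TS) -[ltnLHS]addn0 ltn_add2l (bigD1 e) ?inE ?eS ?eT //=.
by rewrite addn_gt0 wt_gt0.
Qed.

Lemma valid_inj S : valid S -> {in S &, injective snd}.
Proof.
move=> /validP[_ _ SP] [[] i] [[] j] iS jS /= ij; subst j => //.
  by have := SP _ _ jS iS; rewrite ltnn.
by have := SP _ _ iS jS; rewrite ltnn.
Qed.

Lemma vdeg_le_cdeg S e : e \in S -> (vdeg e <= cdeg S)%MM.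
Proof. by move=> eS; rewrite /cdeg (bigD1 e) //= lem_addr. Qed.

(** Members of a cell involve distinct variables, so their product divides a monomial as soon as
    each factor does. *)
Lemma cdeg_le S a : cell S ->
  (cdeg S <= a)%MM = (S \subset [set e | (vdeg e <= a)%MM]).
Proof.
move=> cS; apply/idP/subsetP => [Sa e eS|Sa].
  by rewrite inE (lepm_trans (vdeg_le_cdeg eS)).
case/orP: cS => [/eqP->|vS].
  by rewrite cdeg0; apply/mnm_lepP => i; rewrite mnm0E.
have snd_inj := valid_inj vS.
apply/mnm_lepP => i; rewrite /cdeg mnm_sumE.
have vdegE e : vdeg e i = ((e.2 == i) * wt e)%N by rewrite mulmnE mnm1E.
have [/exists_inP[e eS /eqP ei]|/exists_inPn nS] :=
  boolP [exists e in S, e.2 == i].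
  rewrite (bigD1 e) //= big1 ?addn0 => [|t /andP[tS te]].
    by have := Sa e eS; rewrite inE => /mnm_lepP.
  rewrite vdegE; case: eqP => // ti; case/eqP: te.
  by apply: snd_inj; rewrite // ti.
by rewrite big1 // => e eS; rewrite vdegE (negPf (nS e eS)).
Qed.

(** The subtraction of exponents is truncated, but exact whenever [inc S T] is nonzero, as then [T]
    is contained in [S]. *)
Definition entry S T : R := inc S T *: 'X_[(cdeg S - cdeg T)%MM].

Lemma entry_neq0 S T : entry S T != 0 -> inc S T != 0.
Proof. by apply: contraNneq => E; rewrite /entry E scale0r. Qed.

Lemma entry_entry S T : cell S -> cell T ->
  \sum_(S' | cell S') entry S S' * entry S' T = 0.
Proof.
move=> cS cT.
transitivity (\sum_(S' | cell S') (inc S S' * inc S' T) *: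
                ('X_[(cdeg S - cdeg T)%MM] : R)).
  apply: eq_bigr => S' _; rewrite /entry -scalerAl -scalerAr scalerA -mpolyXD.
  have [->|SS'] := eqVneq (inc S S') 0; first by rewrite mul0r !scale0r.
  have [->|S'T] := eqVneq (inc S' T) 0; first by rewrite mulr0 !scale0r.
  by rewrite (addmBA _ (cdeg_sub (inc_neq0_sub S'T))) submK //
    cdeg_sub ?(inc_neq0_sub SS').
by rewrite -scaler_suml inc_inc ?scale0r.
Qed.

Lemma mcoeffMX_sub (p : R) m a :
  (p * 'X_[m])@_a = if (m <= a)%MM then p@_(a - m)%MM else 0.
Proof.
case: ifPn => [/submK ma|ma]; first by rewrite -{1}ma addmC mcoeffMX.
apply/eqP; rewrite mcoeff_eq0 (perm_mem (msuppMX _ _)).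
by apply: contra ma => /mapP[b _ ->]; apply: lem_addr.
Qed.

Section Exact.
Variable u : {set vertex} -> R.
Hypothesis u0 : u set0 = 0.
Hypothesis u_cycle :
  forall T, cell T -> \sum_(S | cell S) u S * entry S T = 0.

(* The components of degree a of chains are the k-valued chains supported on
   the faces of divisors a. *)
Let divisors a := [set e | (vdeg e <= a)%MM].

Let strand a S : k :=
  if cell S && (S \subset divisors a) then (u S)@_(a - cdeg S) else 0.

(** For [T] supported on the divisors, this is the cycle relation of [u] at [T], read at the
    monomial of exponent [a - cdeg T]. *)
Lemma strand_cycle a : cycle (strand a).
Proof.
move=> T cT; rewrite /bd.
have [Ta|Ta] := boolP (T \subset divisors a); last first.
  rewrite big1 // => S cS; rewrite /strand cS /=; case: ifPn => Sa;
    rewrite ?mul0r //.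
  have [->|/inc_neq0_sub TS] := eqVneq (inc S T) 0; first by rewrite mulr0.
  by rewrite (subset_trans TS Sa) in Ta.
rewrite -[RHS](mcoeff0 k (a - cdeg T)) -(u_cycle cT) raddf_sum /=.
apply: eq_bigr => S cS; rewrite /strand cS /= /entry -scalerAr mcoeffZ mulrC.
have [->|/inc_neq0_sub/cdeg_sub TS] := eqVneq (inc S T) 0.
  by rewrite !mul0r.
congr (_ * _); rewrite mcoeffMX_sub -cdeg_le //.
have -> : (cdeg S - cdeg T <= a - cdeg T)%MM = (cdeg S <= a)%MM.
  rewrite -cdeg_le // in Ta.
  apply/mnm_lepP/mnm_lepP => Sa i; move: (Sa i); rewrite !mnmBE.
    by rewrite leq_sub2rE // (mnm_lepP Ta).
  exact: leq_sub2r.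
case: ifP => // Sa; congr (_@__).
by rewrite submDA [(cdeg T + _)%MM]addmC submK.
Qed.

Lemma entry_exact : exists v,
  forall T, cell T -> u T = \sum_(S | cell S) v S * entry S T.
Proof.
have /choice[g gP] a :
  exists g, (forall S, ~~ (S \subset divisors a) -> g S = 0) /\
    forall T, cell T -> strand a T = bd g T.
  apply: bd_exact; first exact: strand_cycle.
    by rewrite /strand u0 mcoeff0 if_same.
  by move=> S /negPf Sa; rewrite /strand Sa andbF.
(* The finitely many multidegrees in which [u] has a component. Each strand is filled over the field
   and the fillings are reassembled. *)
pose L : seq 'X_{1..n} :=
  undup (flatten
    [seq [seq (m + cdeg X)%MM | m <- msupp (u X)] | X : {set vertex}]).
exists (fun S => \sum_(a <- L) g a S *: 'X_[(a - cdeg S)%MM]) => T cT.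
transitivity (\sum_(a <- L) strand a T *: ('X_[(a - cdeg T)%MM] : R));
  last first.
  under [RHS]eq_bigr do rewrite mulr_suml.
  rewrite exchange_big /=; apply: eq_bigr => a _.
  rewrite (gP a).2 // /bd scaler_suml; apply: eq_bigr => S cS.
  have [Sa|/(gP a).1->] := boolP (S \subset divisors a); last first.
    by rewrite mul0r !scale0r mul0r.
  rewrite -cdeg_le // in Sa;
    rewrite /entry -scalerAl -scalerAr scalerA -mpolyXD.
  have [->|/inc_neq0_sub/cdeg_sub TS] := eqVneq (inc S T) 0.
    by rewrite mulr0 !scale0r.
  by rewrite (addmBA _ TS) submK.
have strandE m : strand (m + cdeg T) T = (u T)@_m.
  by rewrite /strand cT -cdeg_le // lem_addl addmK.
apply/mpolyP => m; rewrite raddf_sum /=.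
have L0 a : a != (m + cdeg T)%MM ->
    (strand a T *: ('X_[(a - cdeg T)%MM] : R))@_m = 0.
  move=> am; rewrite mcoeffZ mcoeffX /strand cT -cdeg_le //=.
  case: ifP => [Ta|]; last by rewrite mul0r.
  case: eqP => [E|]; last by rewrite mulr0.
  by rewrite -E submK // eqxx in am.
have [mL|mL] := boolP ((m + cdeg T)%MM \in L).
  rewrite (bigD1_seq _ mL) ?undup_uniq //= big1 // addr0.
  by rewrite strandE mcoeffZ mcoeffX addmK eqxx mulr1.
rewrite big_seq big1 => [|a aL]; last by apply: L0; apply: contraNneq mL => <-.
apply/eqP; rewrite mcoeff_eq0; apply: contra mL => mT.
rewrite mem_undup; apply/flatten_mapP; exists T; rewrite ?mem_enum //.
by apply: map_f.
Qed.

End Exact.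

End MonomialComplex.

(** * The minimal graded resolution of the edge ideal quotient *)

Section Resolution.
Variables (k : fieldType) (n : nat) (K : weighted_oriented_graph n).
Hypothesis natural : naturally_oriented_complete K.
Local Notation R := {mpoly k[n]}.
Local Notation vertex := (bool * 'I_n)%type.
Local Notation w := (wog_weight K).
Local Notation cdeg := (cdeg w).
Local Notation entry := (entry k w).
Local Notation I := (edge_ideal k K).
Let w_gt0 : forall i, (0 < w i)%N := @wog_weight_gt0 _ K.
Implicit Types (S T : {set vertex}).

Definition lev i : {set {set vertex}} :=
  [set S : {set vertex} | cell S && (#|S|.-1 == i)].

Definition rank i := #|lev i|.

Definition face i (r : 'I_(rank i)) : {set vertex} := enum_val r.

Lemma face_lev i (r : 'I_(rank i)) : face r \in lev i.
Proof. exact: enum_valP. Qed.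

Lemma face_cell i (r : 'I_(rank i)) : cell (face r).
Proof. by have := face_lev r; rewrite inE => /andP[]. Qed.

Lemma faceP i S : S \in lev i -> exists r : 'I_(rank i), face r = S.
Proof. by move=> SL; exists (enum_rank_in SL S); apply: enum_rankK_in. Qed.

Lemma sum_face i (F : {set vertex} -> R) :
  \sum_(r < rank i) F (face r) = \sum_(S in lev i) F S.
Proof. by rewrite [RHS]big_enum_val. Qed.

Lemma lev0 : lev 0 = [set set0].
Proof.
apply/setP => S; rewrite !inE; apply/andP/eqP => [[]|->]; last first.
  by rewrite /cell eqxx cards0.
case/orP => [/eqP//|/valid_card_gt1 S1 /eqP S0].
by case: #|S| S1 S0 => [|[]].
Qed.

Lemma face0 (r : 'I_(rank 0)) : face r = set0.
Proof. by have := face_lev r; rewrite lev0 inE => /eqP. Qed.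

Lemma levS_valid i S : S \in lev i.+1 -> valid S /\ #|S| = i.+2.
Proof.
rewrite inE => /andP[/orP[/eqP->|vS]]; first by rewrite cards0.
by have := valid_card_gt1 vS; case: #|S| => [|[|m]] // _ /eqP[->].
Qed.

Lemma valid_lev i S : valid S -> #|S| = i.+2 -> S \in lev i.+1.
Proof. by move=> vS cS; rewrite inE /cell vS orbT cS /=. Qed.

Lemma entry_lev i S T : cell S -> cell T -> T \in lev i -> entry S T != 0 ->
  S \in lev i.+1.
Proof.
move=> cS cT; rewrite !inE cS /= => /andP[_ /eqP <-] /entry_neq0 ST.
by rewrite (inc_neq0_card cS cT ST).
Qed.

Definition bmx i : 'M[R]_(rank i.+1, rank i) :=
  \matrix_(r, c) entry (face r) (face c).

(** Entries vanish unless the homological degree drops by one, so the sum over one level may run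
    over all cells. *)
Lemma mul_bmx i (u : {set vertex} -> R) (c : 'I_(rank i)) :
  ((\row_r u (face r)) *m bmx i) 0 c =
  \sum_(S | cell S) u S * entry S (face c).
Proof.
rewrite mxE.
transitivity (\sum_(r < rank i.+1) u (face r) * entry (face r) (face c)).
  by apply: eq_bigr => r _; rewrite !mxE.
rewrite (sum_face _ (fun S => u S * entry S (face c))).
rewrite big_mkcond [RHS]big_mkcond /=; apply: eq_bigr => S _.
case: ifPn => [|SL]; first by rewrite inE => /andP[->].
case: ifP => // cS; have [->|ST] := eqVneq (entry S (face c)) 0;
  first by rewrite mulr0.
by rewrite (entry_lev cS _ (face_lev c) ST) ?face_cell in SL.
Qed.

(** Extension by zero; the sum has at most one term because [face] is injective. *)
Definition extend i (u : 'rV[R]_(rank i)) S : R :=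
  \sum_(r | face r == S) u 0 r.

Lemma extend_face i (u : 'rV[R]_(rank i)) r : extend u (face r) = u 0 r.
Proof.
rewrite /extend (big_pred1 r) // => s.
by rewrite (inj_eq enum_val_inj).
Qed.

Lemma extend_out i (u : 'rV[R]_(rank i)) S : S \notin lev i -> extend u S = 0.
Proof.
move=> SL; rewrite /extend big_pred0 // => r; apply: contraNF SL => /eqP <-.
exact: face_lev.
Qed.

Lemma row_extend i (u : 'rV[R]_(rank i)) : \row_r extend u (face r) = u.
Proof. by apply/rowP => r; rewrite mxE extend_face. Qed.

Lemma bmx_bmx i : bmx i.+1 *m bmx i = 0.
Proof.
apply/matrixP => r c; rewrite [RHS]mxE.
rewrite -(entry_entry k w (face_cell r) (face_cell c)).
rewrite -(mul_bmx (fun S => entry (face r) S)) !mxE.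
by apply: eq_bigr => s _; rewrite !mxE.
Qed.

Lemma bmx_exact i (u : 'rV[R]_(rank i.+1)) :
  u *m bmx i = 0 <-> exists v, v *m bmx i.+1 = u.
Proof.
split=> [ud|[v <-]]; last by rewrite -mulmxA bmx_bmx mulmx0.
have [||v vE] := @entry_exact k n w (extend u).
- apply: extend_out; apply/negP => /levS_valid[/valid_neq0].
  by rewrite eqxx.
- move=> T cT; have [TL|TL] := boolP (T \in lev i).
    have [c <-] := faceP TL.
    by rewrite -mul_bmx row_extend ud mxE.
  rewrite big1 // => S cS; have [SL|/extend_out->] := boolP (S \in lev i.+1);
    last first.
    by rewrite mul0r.
  have [->|/entry_neq0/(inc_neq0_card cS cT) E] := eqVneq (entry S T) 0;
    first by rewrite mulr0.
  by move: SL TL; rewrite !inE cS cT E eqSS => ->.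
exists (\row_r v (face r)); apply/rowP => c.
by rewrite mul_bmx -vE ?face_cell // extend_face.
Qed.

Lemma edge_ideal_memP (p : R) :
  p \in I <-> exists c : 'I_n * 'I_n -> R,
    p = \sum_(t : 'I_n * 'I_n | (t.1 < t.2)%N)
          c t * ('X_(t.1) * 'X_(t.2) ^+ w t.2).
Proof.
split=> [/asboolP[c ->]|[c ->]]; last apply/asboolP; exists c;
  by apply: eq_bigl => t; rewrite natural.
Qed.

Definition pair_cell (t : 'I_n * 'I_n) : {set vertex} :=
  [set (false, t.1); (true, t.2)].

Lemma pair_cell_inj : injective pair_cell.
Proof.
move=> [a b] [c d] /setP E.
have := E (false, a); have := E (true, b); rewrite !inE /= !eqxx ?orbT /= ?orbF.
by move=> /esym/eqP[->] /esym/eqP[->].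
Qed.

Lemma sum_lev1 (F : {set vertex} -> R) :
  \sum_(S in lev 1) F S =
  \sum_(t : 'I_n * 'I_n | (t.1 < t.2)%N) F (pair_cell t).
Proof.
have -> : lev 1 = pair_cell @: [set t : 'I_n * 'I_n | (t.1 < t.2)%N].
  apply/setP => S; apply/idP/imsetP => [/levS_valid[vS S2]|[[i j]]].
    have [[i iS] [j jS] SP] := validP _ vS.
    exists (i, j); first by rewrite inE SP.
    apply/esym/eqP; rewrite eqEcard cards2 /= S2 andbT.
    by rewrite subUset !sub1set iS jS.
  rewrite inE /= => ij ->; apply: valid_lev; last by rewrite cards2.
  apply/validP; split; [by exists i; rewrite set21|by exists j; rewrite set22|].
  by move=> a b; rewrite !inE /= ?orbF => /eqP[->] /eqP[->].
rewrite big_imset /=; last by move=> x y _ _; apply: pair_cell_inj.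
by apply: eq_bigl => t; rewrite inE.
Qed.

Lemma entry_pair (t : 'I_n * 'I_n) : (t.1 < t.2)%N ->
  entry (pair_cell t) set0 = 'X_(t.1) * 'X_(t.2) ^+ w t.2.
Proof.
move=> ij; have PL : pair_cell t \in lev 1.
  apply: valid_lev; last by rewrite cards2.
  apply/validP; split;
    [by exists t.1; rewrite set21|by exists t.2; rewrite set22|].
  by move=> a b; rewrite !inE /= ?orbF => /eqP[->] /eqP[->].
have [vP P2] := levS_valid PL.
rewrite /entry inc0r vP P2 /= scale1r cdeg0 subm0 /cdeg.
by rewrite big_setU1 ?inE //= big_set1 /vdeg /= mulm1n mpolyXD mpolyXn.
Qed.

(** [rank 0] is 1, so the sum is the sole coordinate, written without naming its index. *)
Definition aug (u : 'rV[R]_(rank 0)) : quotmod I := quotmod_pi I (\sum_r u 0 r).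

Lemma aug_is_linear : linear aug.
Proof.
move=> c u v; rewrite /aug [c *: quotmod_pi _ _](quotmod_scale_pi I c).
rewrite -quotmod_piD; congr quotmod_pi.
transitivity (c * (\sum_r u 0 r) + \sum_r v 0 r); last by [].
by rewrite mulr_sumr -big_split /=; apply: eq_bigr => r _; rewrite !mxE.
Qed.

HB.instance Definition _ :=
  GRing.isLinear.Build R 'rV[R]_(rank 0) (quotmod I) *:%R aug aug_is_linear.

Lemma quotmod_pi0 (p : R) : quotmod_pi I p = 0 <-> p \in I.
Proof.
rewrite -[p in X in _ <-> X]subr0 -quotmod_piP.
suff -> : quotmod_pi I 0 = 0 by [].
have := quotmod_piD I 0 0; rewrite addr0 -{1}[quotmod_pi I 0]addr0.
by move/addrI.
Qed.

Lemma sum_rank0 (F : 'I_(rank 0) -> R) : exists r0 : 'I_(rank 0),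
  \sum_r F r = F r0 /\ forall r, r = r0.
Proof.
have r0L : set0 \in lev 0 by rewrite lev0 inE.
have [r0 _] := faceP r0L.
have r0U r : r = r0 by apply: enum_val_inj; rewrite -!/(face _) !face0.
exists r0; split=> //; rewrite (big_pred1 r0) // => r /=.
by rewrite [r]r0U eqxx.
Qed.

Lemma aug_surj x : exists u, aug u = x.
Proof.
exists (const_mx (repr x)); rewrite /aug.
have [r0 [-> _]] := sum_rank0 (fun r =>
  (const_mx (repr x) : 'rV[R]_(rank 0)) 0 r).
by rewrite mxE; apply: quotmod_reprK.
Qed.

(** [bmx 0] is the column of generators x_i x_j^w_j, so its image is the edge ideal. *)
Lemma aug_exact u : aug u = 0 <-> exists v, v *m bmx 0 = u.
Proof.
have [r0 [uE r0U]] := sum_rank0 (u 0).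
rewrite /aug uE quotmod_pi0 edge_ideal_memP.
have sumE (V : {set vertex} -> R) :
    ((\row_r V (face r)) *m bmx 0) 0 r0 =
    \sum_(t : 'I_n * 'I_n | (t.1 < t.2)%N)
      V (pair_cell t) * ('X_(t.1) * 'X_(t.2) ^+ w t.2).
  rewrite mxE.
  transitivity (\sum_(r < rank 1) V (face r) * entry (face r) set0).
    by apply: eq_bigr => r _; rewrite !mxE face0.
  rewrite (sum_face _ (fun S => V S * entry S set0)) sum_lev1.
  by apply: eq_bigr => t tt; rewrite entry_pair.
split=> [[c cE]|[v vE]].
  pose V S := \sum_(t | pair_cell t == S) c t.
  exists (\row_r V (face r)); apply/rowP => r; rewrite [r]r0U sumE cE.
  apply: eq_bigr => t _; congr (_ * _); rewrite /V (big_pred1 t) // => s.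
  by rewrite (inj_eq pair_cell_inj).
exists (fun t => extend v (pair_cell t)).
by rewrite -sumE row_extend vE.
Qed.

Lemma entry_homog S T :
  homog_deg ((mdeg (cdeg S))%:Z - (mdeg (cdeg T))%:Z) (entry S T).
Proof.
apply/homog_degP => m md; rewrite mcoeffZ mcoeffX.
have [->|/inc_neq0_sub TS] := eqVneq (inc k S T) 0; first by rewrite mul0r.
case: eqP => [E|_]; last by rewrite mulr0.
have := submK (cdeg_sub w TS); rewrite E => /(congr1 mdeg).
by rewrite mdegD => D; rewrite -D PoszD addrK eqxx in md.
Qed.

Lemma aug_homog (r : 'I_(rank 0)) :
  quot_homog (I := I) (mdeg (cdeg (face r)))%:Z (aug (delta_mx 0 r)).
Proof.
exists 1; first by rewrite face0 cdeg0 mdeg0 /=; apply: dhomog1.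
rewrite /aug; congr quotmod_pi.
have [r0 [-> r0U]] := sum_rank0 ((delta_mx 0 r : 'rV[R]_(rank 0)) 0).
by rewrite mxE -(r0U r) !eqxx.
Qed.

Definition resolution : graded_free_resolution (quot_homog (I := I)) :=
  @GradedFreeResolution k n (quotmod I) (quot_homog (I := I)) rank
    (fun i r => (mdeg (cdeg (face r)))%:Z) bmx (aug : {linear _ -> _})
    aug_homog
    (fun i r c =>
       eq_ind_r (homog_deg _) (entry_homog (face r) (face c)) (mxE _ _ r c))
    aug_surj aug_exact bmx_exact.

(** A nonzero entry goes from a cell to a proper subset, and weights are positive, so its monomial
    has positive degree. *)
Lemma resolution_minimal : gf_minimal resolution.
Proof.
move=> i r c; rewrite mxE mcoeffZ mcoeffX.
have [->|ST] := eqVneq (inc k (face r) (face c)) 0; first by rewrite mul0r.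
have pr : face c \proper face r.
  rewrite properEneq (inc_neq0_sub ST) andbT; apply/eqP => E.
  by have := inc_neq0_card (face_cell r) (face_cell c) ST; rewrite E;
    elim: (_.-1) => // m IH [].
case: eqP => [E|_]; last by rewrite mulr0.
have := mdeg_cdeg_proper w_gt0 pr.
by rewrite -(submK (cdeg_sub w (inc_neq0_sub ST))) E add0m ltnn.
Qed.

End Resolution.

(** * Projective dimension and regularity *)

Section Invariants.
Variables (k : fieldType) (n : nat) (K : weighted_oriented_graph n).
Hypothesis natural : naturally_oriented_complete K.
Local Notation w := (wog_weight K).
Local Notation I := (edge_ideal k K).
Local Notation G := (resolution k natural).
Let w_gt0 : forall i, (0 < w i)%N := @wog_weight_gt0 _ K.
Implicit Types (S : {set bool * 'I_n}).

Lemma valid_card_le S : valid S -> (#|S| <= n)%N.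
Proof.
move=> vS; rewrite -[leqRHS]card_ord -(card_in_imset (valid_inj vS)).
exact: max_card.
Qed.

Lemma resolution_length i : (n <= i.+1)%N -> gf_rank G i.+1 = 0%N.
Proof.
move=> ni; apply/eqP; rewrite cards_eq0; apply/eqP/setP => S; rewrite in_set0.
apply/negP => /levS_valid[/valid_card_le Sn SE].
by rewrite SE ltnNge ni in Sn.
Qed.

(** Take 1 off every weight: as |S| is at most i + 1, it suffices to bound the sum of [wt - 1] over
    [S] by that of [w - 1] over all vertices. Indices in [S] are distinct and x-tags contribute
    0. *)
Lemma mdeg_cdeg_le i S : S \in lev n i ->
  (mdeg (cdeg w S) + n <= (\sum_j w j)%N + i + 1)%N.
Proof.
rewrite inE => /andP[cS /eqP Si]; rewrite mdeg_cdeg.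
have predE (F : finType) (A : {pred F}) (f : F -> nat) :
  (forall x, 0 < f x)%N ->
    (\sum_(x in A) f x = \sum_(x in A) (f x).-1 + #|A|)%N.
  move=> f0; rewrite -sum1_card -big_split /=.
  by apply: eq_bigr => x _; rewrite addn1 prednK.
have -> : (\sum_j w j = \sum_j (w j).-1 + n)%N.
  by rewrite (predE _ 'I_n) // card_ord.
rewrite (predE _ S) => [|e]; last exact: wt_gt0.
suff : (\sum_(e in S) (wt w e).-1 <= \sum_j (w j).-1)%N by lia.
have snd_inj : {in S &, injective snd}.
  by case/orP: cS => [/eqP->|/valid_inj//] x y; rewrite inE.
apply: (@leq_trans (\sum_(e in S) (w e.2).-1)).
  by apply: leq_sum => -[[] j] _.
rewrite -(big_imset (fun j => (w j).-1) snd_inj) /=.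
by rewrite [leqRHS](bigID (mem (snd @: S))) /= leq_addr.
Qed.

Definition top_cell : {set bool * 'I_n} := [set ((0 < j)%N, j) | j : 'I_n].

Hypothesis n_gt1 : (1 < n)%N.

Lemma top_cell_lev : top_cell \in lev n n.-1.
Proof.
have card_top : #|top_cell| = n.
  by rewrite card_imset ?card_ord // => i j [].
rewrite inE card_top eqxx andbT /cell; apply/orP; right; apply/validP.
have n_gt0 := ltnW n_gt1.
split.
- by exists (Ordinal n_gt0); apply/imsetP; exists (Ordinal n_gt0).
- by exists (Ordinal n_gt1); apply/imsetP; exists (Ordinal n_gt1).
- move=> i j /imsetP[a _ [a0 ->]] /imsetP[b _ [b0 ->]].
  by case: (posnP a) a0 => // -> _; rewrite -b0.
Qed.

(** x_1 enters with exponent 1, which is its weight by the convention w_1 = 1. *)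
Lemma mdeg_top_cell : (forall i : 'I_n, i = 0%N :> nat -> w i = 1%N) ->
  mdeg (cdeg w top_cell) = (\sum_j w j)%N.
Proof.
move=> w1; rewrite mdeg_cdeg big_imset /=; last by move=> i j _ _ [].
apply: eq_bigr => j _; rewrite /wt /=; case: posnP => // j0.
by rewrite w1.
Qed.

Lemma pdim_edge_ideal : pdim_is (quotmod I) n.-1.
Proof.
split=> [|P e Pe].
  exists (free_projective_resolution G) => -[|i] // ni x.
  have /resolution_length r0 : (n <= i.+1)%N by lia.
  by apply/rowP => c; case: (cast_ord r0 c).
(* Lower bound: [top_cell] is a basis element in degree n - 1 of a minimal resolution. *)
apply: (minimal_length_le (@resolution_minimal k n K natural) Pe).
by apply/card_gt0P; exists top_cell; apply: top_cell_lev.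
Qed.

(** Send each basis vector to a homogeneous polynomial representing its image in the quotient; the
    target has rank 1. *)
Lemma resolution_degree0 (F : graded_free_resolution (quot_homog (I := I))) :
  exists2 f : {linear 'rV[{mpoly k[n]}]_(gf_rank F 0) -> 'rV_(gf_rank G 0)},
    graded_map f & forall x, gf_aug G (f x) = gf_aug F x.
Proof.
have /choice[p pP] r : exists p, homog_deg (gf_shift (g := F) (i := 0) r) p /\
    quotmod_pi I p = gf_aug F (delta_mx 0 r).
  by have [p] := gf_aug_homog r; exists p.
have [f fE] := row_linear_ex
  (fun r => const_mx (p r) : 'rV[{mpoly k[n]}]_(gf_rank G 0)).
exists f => [r c|].
  rewrite fE mxE /= face0 cdeg0 mdeg0 subr0; exact: (pP r).1.
apply: (@row_linear_eq _ _ _ (gf_aug G \o f) (gf_aug F)) => r /=.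
rewrite fE /aug -(pP r).2; congr quotmod_pi.
have [r0 [-> _]] := sum_rank0 ((const_mx (p r) :
  'rV[{mpoly k[n]}]_(gf_rank G 0)) 0).
by rewrite mxE.
Qed.

Lemma regularity_edge_ideal :
    (forall i : 'I_n, i = 0%N :> nat -> w i = 1%N) ->
  regularity_is (quot_homog (I := I))
    ((\sum_(i < n) w i)%N%:Z - n%:Z + 1).
Proof.
move=> w1; split.
  have [r rE] := faceP top_cell_lev.
  pose d := (\sum_(i < n) w i)%N%:Z.
  exists n.-1, d, #|[set s | gf_shift (g := G) (i := n.-1) s == d]|; split.
  - by exists G; split=> //; apply: resolution_minimal.
  - apply/eqP; rewrite -lt0n; apply/card_gt0P; exists r.
    by rewrite inE /= rE mdeg_top_cell.
  - by rewrite /d; lia.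
move=> i j b [F [Fmin <-]] /eqP; rewrite -lt0n => /card_gt0P[r].
rewrite inE => /eqP <-.
(* A degree occurring in any minimal resolution occurs in the explicit one, where the degree bound
   on cells applies. *)
have [c ->] := minimal_shift_mem r Fmin (resolution_degree0 F).
by have /= := mdeg_cdeg_le (face_lev c); lia.
Qed.

End Invariants.

Theorem theorem5p2 (k : fieldType) (n : nat) (K : weighted_oriented_graph n)
    (hn : (1 < n)%N)
    (hK : naturally_oriented_complete K)
    (hw1 : forall i : 'I_n, i = 0%N :> nat -> wog_weight K i = 1%N)
    (hp : exists p : 'I_n, (0 < p)%N /\ (1 < wog_weight K p)%N) :
  pdim_is (quotmod (edge_ideal k K)) n.-1 /\
  regularity_is (quot_homog (I := edge_ideal k K))
    ((\sum_(i < n) wog_weight K i)%N%:Z - n%:Z + 1).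
Proof.
split; first exact: pdim_edge_ideal.
exact: regularity_edge_ideal.
Qed.
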